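(* Let $\Omega\subseteq\mathbb{R}^n$ be a bounded, connected open set. Let $\mathrm{H}(X)=\mathbf{H}(A:X)$, $X\in\mathbb{R}^{n\times n}_s$, where $A\in\mathbb{R}^{n\times n}_s$ is a fixed (strictly) positive matrix and $\mathbf{H}\in C^1(\mathbb{R})$ is a non-negative level-convex function such that each level set $\{\mathbf{H}=t\}$ consists of at most $2$ points, and let $\mathrm{E}_\infty(u,\mathcal{O})=\|\mathrm{H}(\mathrm{D}^2u)\|_{L^\infty(\mathcal{O})}$. Then for any $g\in W^{2,\infty}(\Omega)$, the intersection $$C^3(\Omega)\cap W^{2,\infty}_g(\Omega)\cap\mathrm{AM}^2(\mathrm{E}_\infty,\Omega)$$ contains at most one element; namely there is at most one $C^3$ second order Absolute Minimiser $u$ which satisfies $u=g$ and $\mathrm{D}u=\mathrm{D}g$ on $\partial\Omega$. Further, the problem $$\begin{cases}\big(\mathbf{H}'(A:\mathrm{D}^2u)\,A\big)^{\otimes3}:(\mathrm{D}^3u)^{\otimes2}=0&\text{in }\Omega,\\ u=g,\ \ \mathrm{D}u=\mathrm{D}g&\text{on }\partial\Omega,\end{cases}$$ has at most one solution in $C^3(\Omega)\cap W^{2,\infty}_g(\Omega)$.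
   Context: $\mathbb{R}^{n\times n}_s$ is the space of real symmetric $n\times n$ matrices, $X:Y=\sum_{i,j}X_{ij}Y_{ij}$. Strictly positive means positive definite. $\mathbf{H}$ is level-convex if the sublevel sets $\{\mathbf{H}\le t\}$, $t\ge0$, are convex. For a symmetric matrix $M$, $M^{\otimes3}:(\mathrm{D}^3u)^{\otimes2}:=\sum_{i,j,k,l,p,q=1}^nM_{ij}M_{kl}M_{pq}\,\mathrm{D}^3_{ikl}u\,\mathrm{D}^3_{jpq}u$. For a bounded open set $\mathcal{O}$, $W^{2,\infty}_0(\mathcal{O}):=W^{2,\infty}(\mathcal{O})\cap\bigcap_{1<p<\infty}W^{2,p}_0(\mathcal{O})$ (functions with $v=0$, $\mathrm{D}v=0$ on $\partial\mathcal{O}$), and $W^{2,\infty}_g(\Omega):=g+W^{2,\infty}_0(\Omega)$. $u\in\mathrm{AM}^2(\mathrm{E}_\infty,\Omega)$ ($u$ is a second order Absolute Minimiser) means $u\in W^{2,\infty}(\Omega)$ and $\mathrm{E}_\infty(u,\Omega')\le\mathrm{E}_\infty(u+\phi,\Omega')$ for all open $\Omega'\Subset\Omega$ and all $\phi\in W^{2,\infty}_0(\Omega')$. *)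

(* Defs.v *)
From HB Require Import structures.
From mathcomp Require Import all_boot all_order all_algebra.
From mathcomp Require Import all_classical all_reals all_analysis.

Set Implicit Arguments.
Unset Strict Implicit.
Unset Printing Implicit Defensive.

Import Order.TTheory GRing.Theory Num.Theory.
Import numFieldNormedType.Exports.

Local Open Scope classical_set_scope.
Local Open Scope ring_scope.

Definition measure_rV_display : measure_display -> measure_display.
Proof. exact. Qed.

(* Generated by the coordinate projections, as the library does for tuples;
   this is the Borel sigma-algebra of 'rV[R]_n. *)
Section measurable_rV.
Context {R : realType}.
Variable n : nat.

Definition rV_coord (i : 'I_n) (x : 'rV[R]_n) : R := x 0 i.

Let rV_set0 : g_sigma_preimage rV_coord set0.
Proof. exact: sigma_algebra0. Qed.

Let rV_setC A : g_sigma_preimage rV_coord A -> g_sigma_preimage rV_coord (~` A).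
Proof. exact: sigma_algebraC. Qed.

Let rV_bigcup (F : _^nat) : (forall i, g_sigma_preimage rV_coord (F i)) ->
  g_sigma_preimage rV_coord (\bigcup_i (F i)).
Proof. exact: sigma_algebra_bigcup. Qed.

HB.instance Definition _ := @isMeasurable.Build
  (measure_rV_display default_measure_display)
  'rV[R]_n (g_sigma_preimage rV_coord) rV_set0 rV_setC rV_bigcup.

End measurable_rV.

Lemma measurable_rV_coord (R : realType) n (i : 'I_n) :
  measurable_fun [set: 'rV[R]_n] (rV_coord i).
Proof.
move=> _ Y mY; rewrite setTI; apply: sub_sigma_algebra => /=.
rewrite -bigcup_seq/=; exists i => /=; first by rewrite mem_index_enum.
by exists Y => //; rewrite setTI.
Qed.

Lemma measurable_fun_rVP (R : realType) d (T : measurableType d) n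
    (f : T -> 'rV[R]_n) :
  measurable_fun [set: T] f <->
  forall i, measurable_fun [set: T] (rV_coord i \o f).
Proof.
split=> [mf i|mf].
  exact: (measurableT_comp (measurable_rV_coord i) mf).
apply: (@measurability _ _ T 'rV[R]_n _ _ (\big[setU/set0]_(i < n)
  preimage_set_system setT (@rV_coord R n i) measurable)) => //.
move=> _ [A + <-]; rewrite -bigcup_seq/= => -[i _ [B mB <-]].
by rewrite setTI; exact: mf.
Qed.

Section lebesgue_rV_succ.
Context {R : realType}.
Variable n : nat.

Definition rV_cons (p : R * 'rV[R]_n) : 'rV[R]_n.+1 :=
  \row_i oapp (p.2 0) p.1 (unlift ord0 i).

Definition rV_uncons (x : 'rV[R]_n.+1) : R * 'rV[R]_n :=
  (x 0 0, \row_i x 0 (lift ord0 i)).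

Lemma rV_consK : cancel rV_cons rV_uncons.
Proof.
move=> [a v]; rewrite /rV_uncons/rV_cons mxE unlift_none/=; congr pair.
by apply/rowP => i; rewrite !mxE liftK.
Qed.

Lemma rV_unconsK : cancel rV_uncons rV_cons.
Proof.
move=> x; apply/rowP => i; rewrite mxE.
by case: unliftP => [j ->|->] /=; rewrite ?mxE.
Qed.

Lemma measurable_rV_cons : measurable_fun setT rV_cons.
Proof.
apply/measurable_fun_rVP => i.
have [->|[j ->]] : i = ord0 \/ exists j, i = lift ord0 j.
  by case: (unliftP ord0 i) => [j ->|->]; [right; exists j|left].
- rewrite [X in measurable_fun _ X](_ : _ = fst)//.
  by apply/funext => p; rewrite /rV_coord/= mxE unlift_none.
- rewrite [X in measurable_fun _ X](_ : _ = rV_coord j \o snd).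
    apply: measurableT_comp; first exact: measurable_rV_coord.
    exact: measurable_snd.
  by apply/funext => p; rewrite /rV_coord/= mxE liftK.
Qed.

Lemma measurable_rV_uncons : measurable_fun setT rV_uncons.
Proof.
apply/measurable_fun_pairP; split.
  exact: (measurable_rV_coord ord0).
apply/measurable_fun_rVP => i.
rewrite [X in measurable_fun _ X](_ : _ = rV_coord (lift ord0 i)).
  exact: measurable_rV_coord.
by apply/funext => x; rewrite /rV_coord/= mxE.
Qed.

Variable m : {sigma_finite_measure set 'rV[R]_n -> \bar R}.

Definition lebesgue_rV_succ : set 'rV[R]_n.+1 -> \bar R :=
  pushforward (@lebesgue_measure R \x m)%E rV_cons.

Let succ_measure : {measure set 'rV[R]_n.+1 -> \bar R} :=
  measure_function_pushforward__canonical__measure_function_Measure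
    (@lebesgue_measure R \x m)%E measurable_rV_cons.

HB.instance Definition _ := isMeasure.Build _ _ _ lebesgue_rV_succ
  (measure0 succ_measure) (measure_ge0 succ_measure)
  (@measure_semi_sigma_additive _ _ _ succ_measure).

Let succ_sigma_finite : sigma_finite setT lebesgue_rV_succ.
Proof.
have /sigma_finiteP[F [TF ndF mF]] := sigma_finiteT (@lebesgue_measure R).
have /sigma_finiteP[G [TG ndG mG]] := sigma_finiteT m.
exists (fun k => rV_uncons @^-1` (F k `*` G k)).
  apply/seteqP; split => // x _.
  have [k _ Fk] : (\bigcup_k F k) (rV_uncons x).1 by rewrite -TF.
  have [l _ Gl] : (\bigcup_k G k) (rV_uncons x).2 by rewrite -TG.
  exists (maxn k l) => //; split.
    by move: Fk; exact/subsetPset/ndF/leq_maxl.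
  by move: Gl; exact/subsetPset/ndG/leq_maxr.
move=> k; have [? ?] := mF k; have [? ?] := mG k; split.
  rewrite -[X in measurable X]setTI.
  by apply: measurable_rV_uncons => //; exact: measurableX.
rewrite /lebesgue_rV_succ /pushforward -comp_preimage.
rewrite (_ : rV_uncons \o rV_cons = id); last first.
  by apply/funext => p; exact: rV_consK.
by rewrite preimage_id product_measure1E// lte_mul_pinfty// ge0_fin_numE.
Qed.

HB.instance Definition _ := Measure_isSigmaFinite.Build _ _ _ lebesgue_rV_succ
  succ_sigma_finite.

End lebesgue_rV_succ.

(* Borel-Lebesgue measure on R^n as an iterated product; lebesgue_rV_box gives
   its value on boxes, which characterizes it. *)
Fixpoint lebesgue_rV (R : realType) (n : nat) :
    {sigma_finite_measure set 'rV[R]_n -> \bar R} :=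
  if n is k.+1 then lebesgue_rV_succ (lebesgue_rV R k) else \d_(0 : 'rV[R]_0).

Lemma lebesgue_rV_box (R : realType) n (B : 'I_n -> set R) :
  (forall i, measurable (B i)) ->
  lebesgue_rV R n [set x | forall i, B i (x 0 i)] =
  (\prod_(i < n) lebesgue_measure (B i))%E.
Proof.
elim: n B => [|n IH] B mB /=.
  rewrite big_ord0 diracE mem_set//.
  by case.
have consE : @rV_cons R n @^-1` [set x | forall i, B i (x 0 i)] =
    B ord0 `*` [set x : 'rV[R]_n | forall i, B (lift ord0 i) (x 0 i)].
  apply/seteqP; split => -[a v] /= h.
    split; first by have := h ord0; rewrite mxE unlift_none.
    by move=> i; have := h (lift ord0 i); rewrite mxE liftK.
  by case: h => /= ha hv i; rewrite mxE; case: unliftP => [j ->|->] /=.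
have mB' : measurable [set x : 'rV[R]_n | forall i, B (lift ord0 i) (x 0 i)].
  rewrite [X in measurable X](_ : _ = \bigcap_(i in [set: 'I_n])
      (@rV_coord R n i @^-1` B (lift ord0 i))); last first.
    by apply/seteqP; split => x /= h i => [_|]; exact: h.
  apply: fin_bigcap_measurable => [|i _]; first exact: finite_finset.
  by rewrite -[X in measurable X]setTI; exact: measurable_rV_coord.
transitivity ((@lebesgue_measure R \x lebesgue_rV R n)%E
    (B ord0 `*` [set x : 'rV[R]_n | forall i, B (lift ord0 i) (x 0 i)])).
  by rewrite -consE.
rewrite product_measure1E; [|exact: mB|exact: mB'].
rewrite big_ord_recl; congr (_ * _)%E.
exact: (IH (fun i => B (lift ord0 i))).
Qed.

(* Functions on O are represented by total functions on 'rV[R]_n; only their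
   values on O matter in what follows. *)
Section sobolev.
Context {R : realType} {n : nat}.
Implicit Types (u v phi : 'rV[R]_n -> R) (O K : set 'rV[R]_n) (a : seq 'I_n).

Local Notation leb := (lebesgue_rV R n).

Definition pderiv (i : 'I_n) u : 'rV[R]_n -> R := 'D_(delta_mx 0 i) u.

(* pderivs [:: i; j; k] u is d_i d_j d_k u *)
Definition pderivs a u : 'rV[R]_n -> R := foldr pderiv u a.

Definition Ck (k : nat) O : set ('rV[R]_n -> R) :=
  [set u | forall a, (size a <= k)%N -> forall x, O x ->
     {for x, continuous (pderivs a u)} /\
     ((size a < k)%N -> forall i, derivable (pderivs a u) x (delta_mx 0 i))].

(* C_c^oo(O) *)
Definition test_function O : set ('rV[R]_n -> R) :=
  [set phi | (forall k, Ck k setT phi) /\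
     exists K, [/\ compact K, K `<=` O & forall x, ~ K x -> phi x = 0]].

Definition loc_integrable O u : Prop := measurable_fun O u /\
  forall K, compact K -> K `<=` O -> leb.-integrable K (EFin \o u).

Definition is_weak_deriv O a u v : Prop :=
  [/\ loc_integrable O u, loc_integrable O v &
    forall phi, test_function O phi ->
      \int[leb]_(x in O) (u x * pderivs a phi x) =
      (-1) ^+ size a * \int[leb]_(x in O) (v x * phi x)].

(* A representative of the weak derivative (unique up to null sets); it is a
   junk value when there is none. *)
Definition weak_deriv O a u : 'rV[R]_n -> R := get (is_weak_deriv O a u).

Definition in_Lp (p : \bar R) O u : Prop := u \_ O \in Lfun leb p.

Definition sobolev (k : nat) (p : \bar R) O : set ('rV[R]_n -> R) :=
  [set u | in_Lp p O u /\ forall a, (size a <= k)%N ->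
     exists2 v, is_weak_deriv O a u v & in_Lp p O v].

Definition sobolev_norm (k : nat) (p : \bar R) O u : \bar R :=
  (\sum_(m < k.+1) \sum_(a : m.-tuple 'I_n)
     'N[leb]_p[EFin \o (weak_deriv O a u \_ O)])%E.

(* Closure of C_c^oo(O) in W^{k,p}(O) *)
Definition sobolev0 (k : nat) (p : \bar R) O : set ('rV[R]_n -> R) :=
  [set u | sobolev k p O u /\ forall eps : R, 0 < eps ->
     exists2 phi, test_function O phi &
       (sobolev_norm k p O (u \- phi)%R < eps%:E)%E].

Definition W2oo O : set ('rV[R]_n -> R) := sobolev 2 +oo%E O.

Definition W2oo_0 O : set ('rV[R]_n -> R) :=
  W2oo O `&` [set u | forall p : R, 1 < p -> sobolev0 2 p%:E O u].

Definition W2oo_g O (g : 'rV[R]_n -> R) : set ('rV[R]_n -> R) :=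
  [set u | W2oo_0 O (u \- g)].

Definition weak_hessian O u (x : 'rV[R]_n) : 'M[R]_n :=
  \matrix_(i, j) weak_deriv O [:: i; j] u x.

(* The L^oo(O) norm of H(D^2 u) for the weak Hessian of u in O; extending by 0
   outside O does not change the norm. *)
Definition E_oo (H : 'M[R]_n -> R) u O : \bar R :=
  'N[leb]_+oo[EFin \o ((fun x => H (weak_hessian O u x)) \_ O)].

Definition compactly_contained O' O : Prop :=
  compact (closure O') /\ closure O' `<=` O.

Definition AM2 (E : ('rV[R]_n -> R) -> set 'rV[R]_n -> \bar R) O :
    set ('rV[R]_n -> R) :=
  [set u | W2oo O u /\
     forall O', open O' -> compactly_contained O' O ->
     forall phi, W2oo_0 O' phi -> (E u O' <= E (u \+ phi)%R O')%E].

Definition hessian u (x : 'rV[R]_n) : 'M[R]_n :=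
  \matrix_(i, j) pderivs [:: i; j] u x.

Definition at_most_one_on O (S : set ('rV[R]_n -> R)) : Prop :=
  forall u v, S u -> S v -> forall x, O x -> u x = v x.

End sobolev.

Section matrices.
Context {R : realType} {n : nat}.

Definition mxdot (X Y : 'M[R]_n) : R := \sum_i \sum_j X i j * Y i j.

Definition symmetric_posdef (A : 'M[R]_n) : Prop :=
  A^T = A /\ forall x : 'rV[R]_n, x != 0 -> 0 < (x *m A *m x^T) 0 0.

(* M^{(x)3} : (D^3 u)^{(x)2} at x; the first index of the first D^3 u is
   contracted with that of the second one through M *)
Definition cube_contract (M : 'M[R]_n) (u : 'rV[R]_n -> R) (x : 'rV[R]_n) : R :=
  \sum_i \sum_j \sum_k \sum_l \sum_p \sum_q
    M i j * M k l * M p q *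
    pderivs [:: i; k; l] u x * pderivs [:: j; p; q] u x.

End matrices.

Section scalar_functions.
Context {R : realType}.

Definition C1 (h : R -> R) : Prop :=
  (forall t, derivable h t 1) /\ continuous (derive1 h).

Definition level_convex (h : R -> R) : Prop :=
  forall t : R, 0 <= t -> @convex_set R R^o [set s | h s <= t].

End scalar_functions.

(* Main.v *)
Require Import Defs.
From mathcomp Require Import all_boot all_order all_algebra.
From mathcomp Require Import all_classical all_reals all_analysis.
From mathcomp Require Import measurable_realfun ess_sup_inf ring lra.
Import Order.TTheory GRing.Theory Num.Theory.
Import numFieldNormedType.Exports.
Set Implicit Arguments.
Unset Strict Implicit.
Unset Printing Implicit Defensive.
Local Open Scope classical_set_scope.
Local Open Scope ring_scope.

(** Write L u for A : D^2 u. Both uniqueness claims rest on the same fact about a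
    function u of class C^3: the gradient h'(L u) D(L u) of h(L u) vanishes.

    For a solution of the equation this is algebra: the contraction equals
    h'(L u)^3 times the quadratic form of A at D(L u), and A is positive
    ([cube_contract_eq0]).

    For an absolute minimiser, suppose the gradient is nonzero at x0
    ([AM2_gradient_eq0]). Near x0 the function h is strictly monotone at the
    values of L u, and a partial derivative of L u does not vanish; on a small
    closed ball the maximum of L u (of - L u, if h decreases) is thus attained on
    the sphere only. Let theta = r^2 - |x - x0|^2. Its square belongs to
    W^{2,oo}_0 of the ball ([W2oo_0_sqr]), and on the sphere L(theta^2) is twice
    the quadratic form of A at the gradient of theta, hence positive. Where
    L(theta^2) is not positive, L u stays below its maximum by a margin, so
    subtracting k theta^2 from u with k small lowers the maximum strictly
    ([lower_max]), and with it the supremum of h(L u). This contradicts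
    minimality.

    Consequently h(L u) is constant on the connected set Omega
    ([partial0_connected]); as L u is continuous and the level sets of h have at
    most two points, L u is constant ([level_le2_const]).

    Let now u and v be two such functions with the same boundary data. Then
    w = u - v is a limit of test functions chi in W^{2,2}, and L w is a constant
    c. Since L chi integrates to 0, so does L w, and c = 0. Integrating
    psi chi L(chi) by parts, where psi = M - x_0^2 is nonnegative on Omega and
    L psi = - 2 A_00, gives
      A_00 int chi^2 <= (M^2 / A_00) int (L chi)^2,
    and the right-hand side tends to int (L w)^2 = 0. Hence w = 0
    ([zero_data_unique]).

    A weak derivative is an arbitrary representative, so all this needs the
    uniqueness of weak derivatives, that is the fundamental lemma of the calculus
    of variations ([ae_eq0_test]), and enough test functions. These are built
    from the flat functions t^-m exp(-1/t), which also provide the approximants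
    of theta^2 by test functions. *)

(** * Boxes and measurability in R^n *)

Section boxes.
Context {R : realType} {n : nat}.
Implicit Types (a b x : 'rV[R]_n) (O K : set 'rV[R]_n).

Definition box a b : set 'rV[R]_n := [set x | forall i, a 0 i < x 0 i < b 0 i].
Definition cbox a b : set 'rV[R]_n := [set x | forall i, a 0 i <= x 0 i <= b 0 i].

Lemma rV_ballE x (e : R) (y : 'rV[R]_n) :
  0 < e -> ball x e y <-> forall i, `|x 0 i - y 0 i| < e.
Proof.
move=> e0; split => [[_ h] i|h]; first exact: h.
by split => // i j; rewrite (ord1 i); exact: h.
Qed.

Lemma measurable_box a b : measurable (box a b).
Proof.
rewrite [X in measurable X](_ : _ = \bigcap_(i in [set: 'I_n])
    (@rV_coord R n i @^-1` `]a 0 i, b 0 i[)); last first.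
  apply/seteqP; split => x /= h i => [_|]; rewrite /rV_coord/=.
    by rewrite in_itv/=; exact: h.
  by have := h i I; rewrite /rV_coord /= in_itv.
apply: fin_bigcap_measurable => [|i _]; first exact: finite_finset.
by rewrite -[X in measurable X]setTI; exact: measurable_rV_coord.
Qed.

Lemma compact_cbox a b : compact (cbox a b).
Proof.
rewrite (_ : cbox a b = [set v | forall i, v ord0 i \in `[a 0 i, b 0 i]]).
  by apply: (@rV_compact _ _ (fun i => `[a 0 i, b 0 i]%classic)) => i; exact: segment_compact.
by apply/seteqP; split => x /= h i; have := h i; rewrite in_itv.
Qed.

Definition rat_lo (j : 'rV[rat]_n * nat) : 'rV[R]_n :=
  \row_i (ratr (j.1 0 i) - j.2.+1%:R^-1).
Definition rat_hi (j : 'rV[rat]_n * nat) : 'rV[R]_n :=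
  \row_i (ratr (j.1 0 i) + j.2.+1%:R^-1).
Definition rat_box j : set 'rV[R]_n := box (rat_lo j) (rat_hi j).

(** Rational boxes form a countable base; asking that the closed box lies in the
    open set makes room for compactly supported functions inside it. *)
Lemma rat_box_nbhs O x : open O -> O x -> exists j : 'rV[rat]_n * nat,
  rat_box j x /\ cbox (rat_lo j) (rat_hi j) `<=` O.
Proof.
move=> oO Ox; have /nbhs_ballP[e /= e0 xeO] : nbhs x O by exact: open_nbhs_nbhs.
have [k ke] : exists k : nat, k.+1%:R^-1 < e / 2.
  have e2 : 0 < e / 2 by rewrite divr_gt0.
  exists (Num.truncn (e / 2)^-1).
  by rewrite invf_plt ?posrE//; exact: truncnS_gt.
have d0 : 0 < k.+1%:R^-1 :> R by rewrite invr_gt0.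
set d := k.+1%:R^-1 in ke d0.
have /choice[q hq] : forall i : 'I_n, exists r : rat, ratr r \in `](x 0 i - d), (x 0 i + d)[.
  by move=> i; apply: rat_in_itvoo; rewrite ltrD2l; lra.
exists (\row_i q i, k); split => [i|y hy].
  by rewrite !mxE/= -/d; have := hq i; rewrite in_itv/= => /andP[? ?]; lra.
apply: xeO; apply/rV_ballE => // i.
have := hy i; rewrite !mxE/= -/d; have := hq i; rewrite in_itv/= => /andP[? ?] /andP[? ?].
by rewrite ltr_norml; apply/andP; split; lra.
Qed.

(** The sigma-algebra is generated by the coordinates: open sets are reached as
    countable unions of rational boxes. *)
Lemma open_rV_measurable O : open O -> measurable O.
Proof.
move=> oO.
rewrite (_ : O = \bigcup_(j : 'rV[rat]_n * nat) (if `[< rat_box j `<=` O >] then rat_box j else set0)).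
  apply: countable_bigcupT_measurable => [|j]; first exact: countableP.
  by case: ifP => // _; exact: measurable_box.
apply/seteqP; split => [x Ox|x [j _]]; last by case: asboolP => // jO; exact: jO.
have [j [jx jO]] := rat_box_nbhs oO Ox.
exists j => //; case: asboolP => // -[] y yj; apply: jO => i.
by have /andP[/ltW-> /ltW->] := yj i.
Qed.

Lemma closed_rV_measurable K : closed K -> measurable K.
Proof.
move=> /closed_openC oK; rewrite -(setCK K).
by apply: measurableC; exact: open_rV_measurable.
Qed.

Lemma compact_rV_measurable K : compact K -> measurable K.
Proof. by move=> /(compact_closed (@norm_hausdorff _ _)); exact: closed_rV_measurable. Qed.

Lemma continuous_rV_measurable O (f : 'rV[R]_n -> R) : open O ->
  (forall x, O x -> {for x, continuous f}) -> measurable_fun O f.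
Proof.
move=> oO cf mO; apply: (measurability _ (measurable_realfun.RGenOInfty.measurableE R)) => //.
move=> _ [_ [r ->] <-]; apply: open_rV_measurable.
rewrite openE => x [Ox fx]; apply: filterI; first exact: open_nbhs_nbhs.
apply: (cf x Ox); apply: open_nbhs_nbhs; split => //; exact: interval_open.
Qed.

Local Notation leb := (lebesgue_rV R n).

Lemma lebesgue_rV_boxE a b : (forall i, a 0 i <= b 0 i) ->
  leb (box a b) = (\prod_i (b 0 i - a 0 i))%:E.
Proof.
move=> ab; have -> : box a b = [set x | forall i, `]a 0 i, b 0 i[%classic (x 0 i)].
  by apply/seteqP; split => x /= h i; have := h i; rewrite /= in_itv.
transitivity (\prod_(i < n) lebesgue_measure (`]a ord0 i, b ord0 i[%classic)%R)%E.
  by apply: (lebesgue_rV_box (B := fun i => `]a 0 i, b 0 i[%classic)) => i; exact: measurable_itv.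
rewrite (eq_bigr (fun i => (b 0 i - a 0 i)%:E)) => [|i _]; first by rewrite -prodEFin.
rewrite lebesgue_measure_itv/= lte_fin; case: ltP => //.
by move=> ba; congr EFin; apply/esym/eqP; rewrite subr_eq0 eq_le ba ab.
Qed.

Lemma bounded_sub_box K : bounded_set K -> exists2 M : R, 0 < M &
  K `<=` box (const_mx (- M)) (const_mx M).
Proof.
move=> [M [_ KM]]; exists (`|M| + 2); first by rewrite ltr_wpDl.
move=> x Kx i; rewrite !mxE -ltr_norml.
have /(KM _) /(_ x Kx) xM : M < `|M| + 1.
  by rewrite (le_lt_trans (ler_norm _))// ltrDl.
apply: (@le_lt_trans _ _ `|x|); last by rewrite (le_lt_trans xM)// ltrD2l ltr1n.
rewrite [leRHS]/Num.norm/= mx_normrE.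
by apply/bigmax_geP; right; exists (0, i).
Qed.

Lemma lebesgue_rV_bounded K : measurable K -> bounded_set K -> (leb K < +oo)%E.
Proof.
move=> mK /bounded_sub_box[M M0 KM].
apply: (@le_lt_trans _ _ (leb (box (const_mx (- M)) (const_mx M)))).
  by apply: le_measure; rewrite ?inE//; exact: measurable_box.
by rewrite lebesgue_rV_boxE ?ltry// => i; rewrite !mxE; lra.
Qed.

Lemma lebesgue_rV_compact K : compact K -> (leb K < +oo)%E.
Proof.
move=> cK; apply: lebesgue_rV_bounded; first exact: compact_rV_measurable.
exact: compact_bounded.
Qed.

Lemma lebesgue_rV_open_gt0 O x : open O -> O x -> (0 < leb O)%E.
Proof.
move=> oO /(rat_box_nbhs oO)[j [_ jO]].
apply: (@lt_le_trans _ _ (leb (rat_box j))).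
  rewrite lebesgue_rV_boxE => [|i].
    rewrite lte_fin prodr_gt0// => i _; rewrite !mxE.
    have : 0 < j.2.+1%:R^-1 :> R by rewrite invr_gt0.
    by move: (_^-1) (ratr _) => d r; lra.
  rewrite !mxE; have : 0 < j.2.+1%:R^-1 :> R by rewrite invr_gt0.
  by move: (_^-1) (ratr _) => d r; lra.
apply: le_measure; rewrite ?inE; [exact: measurable_box|exact: open_rV_measurable|].
by move=> y yj; apply: jO => i; have /andP[/ltW-> /ltW->] := yj i.
Qed.

(** Turns almost-everywhere statements about continuous functions into pointwise
    ones. *)
Lemma ae_open_witness O (P : 'rV[R]_n -> Prop) x : open O -> O x ->
  {ae leb, forall y, P y} -> exists2 y, O y & P y.
Proof.
move=> oO Ox [N [mN N0 PN]]; apply: contrapT => nP.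
have ON : O `<=` N by move=> y Oy; apply: PN => /= Py; apply: nP; exists y.
have := lebesgue_rV_open_gt0 oO Ox; rewrite ltNge => /negP; apply.
by rewrite -N0; apply: le_measure; rewrite ?inE//; exact: open_rV_measurable.
Qed.

End boxes.

(** * Integrals of partial derivatives *)

Section divergence.
Context {R : realType}.

(** The difference quotients on both sides are the same function. *)
Lemma is_derive_affine (V W : normedModType R) (phi : V -> W) (f : W -> R)
    (y w : V) (v : W) (d : R) :
  (forall t : R, phi (t *: w + y) = t *: v + phi y) ->
  is_derive (phi y) v f d -> is_derive y w (f \o phi) d.
Proof.
move=> phiE [df <-].
have E : (fun h : R => h^-1 *: ((f \o phi \o shift y) (h *: w) - (f \o phi) y)) =
         (fun h : R => h^-1 *: ((f \o shift (phi y)) (h *: v) - f (phi y))).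
  by apply/funext => h /=; rewrite phiE.
by split; rewrite /derivable /derive E.
Qed.

Lemma is_derive_line (V : normedModType R) (f : V -> R) (x v : V) (t d : R) :
  is_derive (t *: v + x) v f d -> is_derive t 1 (fun s => f (s *: v + x)) d.
Proof.
apply: (@is_derive_affine R^o V (fun s : R => s *: v + x)) => h /=.
by rewrite scalerDl -[h *: 1]/(h * 1) mulr1 addrA.
Qed.

Lemma is_derive_unique (V : normedModType R) (f : V -> R) (x v : V) (d d' : R) :
  is_derive x v f d -> is_derive x v f d' -> d = d'.
Proof. by move=> [_ <-] [_ <-]. Qed.

Lemma continuous_compact_bounded (T : topologicalType) (f : T -> R) (K : set T) :
  (forall x, K x -> {for x, continuous f}) -> compact K -> [bounded f x | x in K].
Proof.
move=> cf cK; have : compact (f @` K).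
  apply: continuous_compact => //; apply: continuous_in_subspaceT => x.
  by rewrite inE; exact: cf.
move/compact_bounded => [M [Mr fM]]; exists M; split => // N MN x Kx.
by apply: fM MN _ _; exists x.
Qed.

Lemma restrict_support (T : Type) (D : set T) (f : T -> R) :
  (forall x, ~ D x -> f x = 0) -> f \_ D = f.
Proof.
move=> f0; apply/funext => x; rewrite patchE; case: ifPn => //.
by rewrite notin_setE => /f0.
Qed.

Section dim.
Variable n : nat.
Local Notation leb := (lebesgue_rV R n).
Implicit Types (K : set 'rV[R]_n) (f : 'rV[R]_n -> R).

Lemma continuous_compact_integrable K f : compact K ->
  measurable_fun K f -> (forall x, K x -> {for x, continuous f}) ->
  leb.-integrable K (EFin \o f).
Proof.
move=> cK mf cf; apply: measurable_bounded_integrable => //.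
- exact: compact_rV_measurable.
- exact: lebesgue_rV_compact.
- exact: continuous_compact_bounded.
Qed.

Lemma compact_support_integrable K f : compact K -> continuous f ->
  (forall x, ~ K x -> f x = 0) -> leb.-integrable setT (EFin \o f).
Proof.
move=> cK cf f0; rewrite -(restrict_support f0) -restrict_EFin.
apply/(integrable_mkcond _ (compact_rV_measurable cK)).
apply: continuous_compact_integrable => //; last by move=> x _; exact: cf.
apply: measurable_funTS.
by apply: continuous_rV_measurable => [|x _]; [exact: openT|exact: cf].
Qed.

Lemma derive_out_support K f (v : 'rV[R]_n) (df : 'rV[R]_n -> R) : closed K ->
  (forall x, ~ K x -> f x = 0) -> (forall x, is_derive x v f (df x)) ->
  forall x, ~ K x -> df x = 0.
Proof.
move=> /closed_openC oK f0 dfx x Kx; apply: is_derive_unique (dfx x) _.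
apply: (@near_eq_is_derive _ _ _ (cst 0)).
near=> y; apply/esym/f0; near: y; exact: open_nbhs_nbhs.
Unshelve. all: by end_near. Qed.

End dim.

Lemma integral_derive1_eq0 (F f : R -> R) (M : R) : 0 < M ->
  (forall t : R, is_derive t (1 : R) F (f t)) -> continuous f ->
  (forall t, M < `|t| -> F t = 0) ->
  (\int[lebesgue_measure]_t (f t)%:E)%E = 0%E.
Proof.
move=> M0 dF cf F0.
have cF t : {for t, continuous F}.
  by apply: differentiable_continuous; apply/derivable1_diffP; have [] := dF t.
have f0 t : ~ `[- (M + 1), M + 1]%classic t -> f t = 0.
  rewrite /= in_itv/= -ler_norml => /negP; rewrite -ltNge => Mt.
  apply: is_derive_unique (dF t) _.
  apply: (@near_eq_is_derive _ _ _ (cst 0)).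
  near=> s; apply/esym/F0.
  have : `|t - s| < 1 by near: s; exact: (@nbhsx_ballx _ R^o).
  by have := ler_normD (t - s) s; rewrite subrK; lra.
transitivity (\int[lebesgue_measure]_(t in `[(- (M + 1))%R, (M + 1)%R]) (f t)%:E)%E.
  by rewrite [RHS]integral_mkcond (restrict_EFin f) restrict_support.
rewrite (@continuous_FTC2 _ f F); first last.
- by move=> t _; rewrite derive1E; have [] := dF t.
- split; [by move=> t _; have [] := dF t|..].
  + exact/cvg_at_right_filter/cF.
  + exact/cvg_at_left_filter/cF.
- by apply: continuous_subspaceT => t; exact: cf.
- by lra.
by rewrite !F0 ?subee// ?normrN gtr0_norm; lra.
Unshelve. all: by end_near. Qed.


Section cons.
Variable n : nat.

Lemma rV_cons_shift0 (t a : R) (v : 'rV[R]_n) :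
  rV_cons (t + a, v) = t *: delta_mx 0 ord0 + rV_cons (a, v).
Proof.
apply/rowP => i; rewrite !mxE eqxx /=; case: (unliftP ord0 i) => [j ->|->] /=.
  by rewrite mulr0 add0r.
by rewrite mulr1.
Qed.

Lemma rV_cons_shiftS (t a : R) (v : 'rV[R]_n) (j : 'I_n) :
  rV_cons (a, t *: delta_mx 0 j + v) =
  t *: delta_mx 0 (lift ord0 j) + rV_cons (a, v).
Proof.
apply/rowP => i; rewrite !mxE eqxx /=; case: (unliftP ord0 i) => [k ->|->] /=.
  by rewrite !mxE (inj_eq (@lift_inj _ ord0)) eqxx.
by rewrite mulr0 add0r.
Qed.

Lemma continuous_rV_consl (v : 'rV[R]_n) : continuous (fun a : R => rV_cons (a, v)).
Proof.
move=> a; apply/cvg_ballP => e e0; near=> b; apply/rV_ballE => // i.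
have [->|[j ->]] : i = ord0 \/ exists j, i = lift ord0 j.
  by case: (unliftP ord0 i) => [j ->|->]; [right; exists j|left].
  by rewrite !mxE unlift_none /=; near: b; exact: (@nbhsx_ballx _ R^o).
by rewrite !mxE liftK /= subrr normr0.
Unshelve. all: by end_near. Qed.

Lemma continuous_rV_consr (a : R) : continuous (fun v : 'rV[R]_n => rV_cons (a, v)).
Proof.
move=> v B /nbhs_ballP[e /= e0 eB]; apply/nbhs_ballP; exists e => // w h.
apply: eB; apply/rV_ballE => // i.
have [->|[j ->]] : i = ord0 \/ exists j, i = lift ord0 j.
  by case: (unliftP ord0 i) => [j ->|->]; [right; exists j|left].
  by rewrite !mxE unlift_none /= subrr normr0.
by rewrite !mxE liftK /=; move/(rV_ballE _ _ e0) : h; exact.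
Qed.

Local Open Scope ereal_scope.
Lemma integral_lebesgue_rV_succE (h : 'rV[R]_n.+1 -> \bar R) : \int[lebesgue_rV R n.+1]_x h x =
  \int[pushforward (@lebesgue_measure R \x lebesgue_rV R n) (@rV_cons R n)]_x h x.
Proof. by [].
Qed.
Lemma ge0_integral_lebesgue_rV_succ (h : 'rV[R]_n.+1 -> \bar R) : measurable_fun setT h -> (forall x, 0 <= h x) ->
  \int[lebesgue_rV R n.+1]_x h x = \int[@lebesgue_measure R \x lebesgue_rV R n]_x h (rV_cons x).
Proof.
move=> mh h0; rewrite integral_lebesgue_rV_succE.
pose mu : {measure set (measurableTypeR R * 'rV[R]_n) -> \bar R} := (@lebesgue_measure R \x lebesgue_rV R n).
have E := @ge0_integral_pushforward _ _ (measurableTypeR R * 'rV[R]_n)%type 'rV[R]_n.+1 R (@rV_cons R n) (@measurable_rV_cons R n) mu setT h measurableT mh (fun x _ => h0 x).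
by rewrite preimage_setT in E.
Qed.
Lemma integral_lebesgue_rV_succ (h : 'rV[R]_n.+1 -> \bar R) : measurable_fun setT h -> (@lebesgue_measure R \x lebesgue_rV R n)%E.-integrable setT (h \o @rV_cons R n) -> 
  \int[lebesgue_rV R n.+1]_x h x = \int[@lebesgue_measure R \x lebesgue_rV R n]_x h (rV_cons x).
Proof. move=> mh h0; rewrite integral_lebesgue_rV_succE.
pose mu : {measure set (measurableTypeR R * 'rV[R]_n) -> \bar R} := (@lebesgue_measure R \x lebesgue_rV R n).
have E := @integral_pushforward _ _ (measurableTypeR R * 'rV[R]_n)%type 'rV[R]_n.+1 R (@rV_cons R n) (@measurable_rV_cons R n) mu setT h mh.
rewrite preimage_setT in E.
by rewrite E.
Qed.

End cons.

(** The measure is an iterated product, so the fundamental theorem of calculus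
    settles the first coordinate and induction on the dimension the others. *)
Lemma integral_partial_eq0 n (i : 'I_n) (F f : 'rV[R]_n -> R) (M : R) : 0 < M ->
  (forall x, is_derive x (delta_mx 0 i : 'rV[R]_n) F (f x)) -> continuous f ->
  (forall x : 'rV[R]_n, (exists j, M < `|x 0 j|) -> F x = 0) ->
  (\int[lebesgue_rV R n]_x (f x)%:E)%E = 0%E.
Proof.
elim: n i F f => [[]//|n IH] i F f M0 dF cf F0.
pose K := cbox (const_mx (- M)) (const_mx M) : set 'rV[R]_n.+1.
have KF0 x : ~ K x -> F x = 0.
  move=> /existsNP[j]; rewrite !mxE -ler_norml => /negP; rewrite -ltNge => xj.
  by apply: F0; exists j.
have f0 : forall x, ~ K x -> f x = 0.
  apply: derive_out_support KF0 dF.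
  by apply: compact_closed; [exact: norm_hausdorff|exact: compact_cbox].
have /measurable_EFinP mf : measurable_fun [set: 'rV[R]_n.+1] f.
  apply: continuous_rV_measurable => [|x _]; last exact: cf.
  exact: openT.
have intf : (lebesgue_rV R n.+1).-integrable setT (EFin \o f).
  by apply: (@compact_support_integrable n.+1 K f _ cf f0); exact: compact_cbox.
have intfc : (@lebesgue_measure R \x lebesgue_rV R n)%E.-integrable setT
    (EFin \o f \o @rV_cons R n).
  apply/integrableP; split.
    by apply: measurableT_comp => //; exact: measurable_rV_cons.
  move/integrableP : intf => [_]; apply: le_lt_trans.
  have h0 (x : 'rV[R]_n.+1) : (0 <= `|(f x)%:E|)%E by exact: abse_ge0.
  rewrite (@ge0_integral_lebesgue_rV_succ n (fun x => `|(f x)%:E|%E)) //.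
  exact: measurableT_comp.
rewrite (@integral_lebesgue_rV_succ n (EFin \o f) mf intfc).
case: (unliftP ord0 i) => [j ij|i0].
- rewrite -(integral12_prod_meas1 intfc) integral0_eq// => a _.
  rewrite /fubini_F.
  apply: (IH j (fun v => F (rV_cons (a, v))) (fun v => f (rV_cons (a, v)))) => //.
  + move=> v; apply: (@is_derive_affine _ _ (fun v => rV_cons (a, v)) _ _ _ (delta_mx 0 i)).
    by move=> t; rewrite rV_cons_shiftS ij.
  + move=> v; apply: (@continuous_comp _ _ _ (fun v => rV_cons (a, v)) f).
      exact: continuous_rV_consr.
    exact: cf.
  + move=> v [k vk]; apply: F0; exists (lift ord0 k).
    by rewrite mxE liftK.
- rewrite -(integral21_prod_meas1 intfc) integral0_eq// => v _.
  rewrite /fubini_G.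
  apply: (@integral_derive1_eq0 (fun a => F (rV_cons (a, v))) (fun a => f (rV_cons (a, v))) M) => //.
  + move=> a; apply: (@is_derive_affine R^o _ (fun a => rV_cons (a, v)) _ _ _ (delta_mx 0 i)).
    by move=> t; rewrite i0 -[t *: 1]/(t * 1) mulr1 rV_cons_shift0.
  + move=> a; apply: (@continuous_comp _ _ _ (fun a : R => rV_cons (a, v)) f).
      exact: continuous_rV_consl.
    exact: cf.
  + move=> a va; apply: F0; exists ord0.
    by rewrite mxE unlift_none.
Qed.

End divergence.

(** * Flat functions and smooth functions *)

Section flat.
Context {R : realType}.

(** The family of flat functions is closed under differentiation, which makes
    its members smooth without any explicit formula for higher derivatives. *)
Definition flat (m : nat) (t : R) : R :=
  if 0 < t then t^-1 ^+ m * expR (- t^-1) else 0.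

(** The k-th power of 1 + y <= exp y at y = s / k. *)
Lemma exprn_le_expR (s : R) (k : nat) : 0 <= s -> s ^+ k <= k%:R ^+ k * expR s.
Proof.
move=> s0; case: k => [|k]; first by rewrite !expr0 mul1r -expR0 ler_expR.
have k0 : 0 < k.+1%:R :> R by [].
have -> : expR s = expR (s / k.+1%:R) ^+ k.+1.
  by rewrite -expRM_natl mulrC divfK// gt_eqF.
rewrite -exprMn ler_pXn2r ?nnegrE ?mulr_ge0 ?expR_ge0//.
rewrite -ler_pdivrMl// mulrC; apply: le_trans (expR_ge1Dx _) => //.
by rewrite lerDr.
Qed.

Lemma flat_ge0 m t : 0 <= flat m t.
Proof. by rewrite /flat; case: ifP => // t0; rewrite mulr_ge0 ?exprn_ge0 ?invr_ge0 ?expR_ge0 ?ltW. Qed.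

Lemma flat_le m t : flat m t <= m%:R ^+ m.
Proof.
rewrite /flat; case: ifP => t0; last by rewrite exprn_ge0.
by rewrite expRN ler_pdivrMr ?expR_gt0// exprn_le_expR// invr_ge0 ltW.
Qed.

Lemma flatS m t : flat m t = flat m.+1 t * t.
Proof.
rewrite /flat; case: ifP => t0; last by rewrite mul0r.
rewrite exprSr -[LHS]mulr1 -(mulVf (x := t)) ?gt_eqF//.
by move: (t^-1 ^+ m) (t^-1) (expR _) => a b e; ring.
Qed.

Lemma flat_le_lin m t : `|flat m t| <= m.+1%:R ^+ m.+1 * `|t|.
Proof.
rewrite flatS normrM ler_wpM2r// ger0_norm ?flat_ge0//; exact: flat_le.
Qed.

Lemma flatN m t : t <= 0 -> flat m t = 0.
Proof. by rewrite /flat ltNge => ->. Qed.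

Lemma flat_is_derive m (t : R) :
  is_derive t (1 : R) (flat m) (flat m.+2 t - m%:R * flat m.+1 t).
Proof.
have [t0|t0|->] := ltrgt0P t.
- pose f := (fun s : R => s^-1 ^+ m * expR (- s^-1)).
  apply: (@near_eq_is_derive _ _ _ f).
    near=> s; have s0 : 0 < s by near: s; exact: lt_nbhsr.
    by rewrite /f /flat s0.
  have tn0 : t != 0 by rewrite gt_eqF.
  have dV : is_derive t (1 : R) (fun s : R => s^-1) (- t ^- 2).
    by apply: is_derive_eq; [exact: is_deriveV|rewrite -[_ *: _]/(_ * _) mulr1].
  have dX : is_derive t (1 : R) (fun s : R => s^-1 ^+ m) (m%:R * t^-1 ^+ m.-1 * - t ^- 2).
    have := is_deriveX m dV; rewrite (_ : (fun s => _) ^+ m = fun s : R => s^-1 ^+ m); last by apply/funext => s; elim: (m) => [|k ih]; rewrite ?expr0 // !exprS -ih.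
    by rewrite -[_ *: _]/(_ * _) mulr_natl.
  have dE : is_derive t (1 : R) (fun s : R => expR (- s^-1)) (expR (- t^-1) * t ^- 2).
    have dN : is_derive t (1 : R) (fun s : R => - s^-1) (t ^- 2).
      by rewrite -[t^-2]opprK; exact: is_deriveN.
    exact: (@is_derive1_comp _ expR (fun s : R => - s^-1)).
  apply: (is_derive_eq (is_deriveM dX dE)); rewrite -![_ *: _]/(_ * _) /flat t0.
  case: m {f dX} => [|k] /=.
    by rewrite !mul0r mulr0 !subr0 addr0 expr0 mul1r -exprVn mulrC.
  rewrite -!exprVn !exprS expr0 mulr1.
  move: (t^-1) (_ ^+ k) (expR _) => a b e; rewrite -natr1.
  by move: (k%:R : R) => c; ring.
- rewrite (flatN _ (ltW t0)) (flatN _ (ltW t0)) mulr0 subr0.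
  apply: (@near_eq_is_derive _ _ _ (cst 0)).
  near=> s; rewrite flatN//; near: s.
  by apply: filterS (lt_nbhsl t0) => s /ltW.
- rewrite !flatN// mulr0 subr0.
  (* the difference quotient of flat m at 0 is flat m.+1 *)
  have q0 : (fun h : R => h^-1 *: ((flat m \o shift 0) (h *: (1 : R)) - flat m 0)) @ 0^' --> 0.
    have C0 : 0 < m.+2%:R ^+ m.+2 :> R by rewrite exprn_gt0.
    apply/cvgr0Pnorm_le => e e0; near=> h.
    have h0 : h != 0 by near: h; exact: nbhs_dnbhs_neq.
    have -> : h^-1 *: ((flat m \o shift 0) (h *: (1 : R)) - flat m 0) = flat m.+1 h.
      rewrite /= addr0 -![_ *: _]/(_ * _) mulr1 (@flatN _ 0)// subr0 flatS mulrC.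
      by rewrite mulfK.
    apply: le_trans (flat_le_lin _ _) _; rewrite -ler_pdivlMl//; near: h.
    by apply: dnbhs0_le; rewrite mulr_gt0// invr_gt0.
  by apply: DeriveDef; [exact: cvgP q0|exact: cvg_lim q0].
Unshelve. all: by end_near. Qed.

Lemma continuous_flat m : continuous (flat m).
Proof.
move=> t; apply: differentiable_continuous; apply/derivable1_diffP.
by have [] := flat_is_derive m t.
Qed.

Lemma flat0_ge t : 0 < t -> 1 - t^-1 <= flat 0 t.
Proof. by move=> t0; rewrite /flat t0 expr0 mul1r; apply: expR_ge1Dx. Qed.

Lemma flatS_le m t : 0 < t -> flat m.+1 t <= m%:R ^+ m / t.
Proof. by move=> t0; rewrite ler_pdivlMr// -flatS flat_le. Qed.

End flat.

Section smooth.
Context {R : realType} {n : nat}.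

(** A syntactic class that is stable under partial derivatives; derivatives of
    every order then exist and are continuous by induction. *)
Inductive smooth : ('rV[R]_n -> R) -> Prop :=
| smooth_cst c : smooth (fun=> c)
| smooth_coord i : smooth (fun x => x 0 i)
| smoothD u v : smooth u -> smooth v -> smooth (fun x => u x + v x)
| smoothM u v : smooth u -> smooth v -> smooth (fun x => u x * v x)
| smooth_flat m u : smooth u -> smooth (fun x => flat m (u x)).

Lemma is_derive_coord (i j : 'I_n) (x : 'rV[R]_n) :
  is_derive x (delta_mx 0 j : 'rV[R]_n) (fun y : 'rV[R]_n => y 0 i) (i == j)%:R.
Proof.
apply: (@is_derive_affine _ _ R^o (fun y : 'rV[R]_n => y 0 i) id _ _ ((i == j)%:R)).
by move=> t; rewrite !mxE eqxx.
Qed.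

(** Along a line, the chain rule is that of one variable. *)
Lemma is_derive_compR (V : normedModType R) (f : R -> R) (u : V -> R) (x v : V) a b :
  is_derive (u x) (1 : R) f a -> is_derive x v u b ->
  is_derive x v (fun y => f (u y)) (a * b).
Proof.
move=> df du.
have dul : is_derive (0 : R) (1 : R) (fun s : R => u (s *: v + x)) b.
  by apply: is_derive_line; rewrite scale0r add0r.
have : is_derive (0 : R) (1 : R) (fun s : R => f (u (s *: v + x))) (a * b).
  apply: (@is_derive1_comp _ f (fun s : R => u (s *: v + x))).
  by rewrite scale0r add0r.
have E : (fun h : R => h^-1 *: (((fun y => f (u y)) \o shift x) (h *: v) - f (u x))) =
  (fun h : R => h^-1 *: (((fun s : R => f (u (s *: v + x))) \o shift 0) (h *: (1 : R))
                        - f (u (0 *: v + x)))).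
  by apply/funext => h /=; rewrite addr0 -[h *: 1]/(h * 1) mulr1 scale0r add0r.
by case; rewrite /derivable /derive -E => dl dE; split.
Qed.

Lemma smooth_continuous u : smooth u -> continuous u.
Proof.
elim=> {u} [c|i|u v _ cu _ cv|u v _ cu _ cv|m u _ cu] x.
- exact: cst_continuous.
- exact: coord_continuous.
- by apply: (@continuousD _ _ _ u v); [exact: cu|exact: cv].
- by apply: (@continuousM _ _ u v); [exact: cu|exact: cv].
- by apply: (@continuous_comp _ _ _ u (flat m)); [exact: cu|exact: continuous_flat].
Qed.

Lemma smooth_is_derive (i : 'I_n) u : smooth u -> exists2 v, smooth v &
  forall x, is_derive x (delta_mx 0 i : 'rV[R]_n) u (v x).
Proof.
elim=> {u} [c|j|u v su [u' su' du] sv [v' sv' dv]|u v su [u' su' du] sv [v' sv' dv]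
           |m u su [u' su' du]].
- by exists (fun=> 0) => [|x]; [exact: smooth_cst|exact: is_derive_cst].
- by exists (fun=> (j == i)%:R) => [|x]; [exact: smooth_cst|exact: is_derive_coord].
- exists (fun x => u' x + v' x) => [|x]; first exact: smoothD.
  exact: is_deriveD.
- exists (fun x => u x * v' x + v x * u' x) => [|x]; last exact: is_deriveM.
  by apply: smoothD; exact: smoothM.
- exists (fun x => (flat m.+2 (u x) + (- m%:R) * flat m.+1 (u x)) * u' x) => [|x].
    apply: smoothM => //; apply: smoothD; first exact: smooth_flat.
    by apply: smoothM; [exact: smooth_cst|exact: smooth_flat].
  rewrite mulNr; apply: (@is_derive_compR _ (flat m)) => //.
  exact: flat_is_derive.
Qed.

Lemma smooth_pderiv i u : smooth u -> smooth (pderiv i u).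
Proof.
move=> /(smooth_is_derive i)[v sv dv].
rewrite (_ : pderiv i u = v)//; apply/funext => x.
by have [_ <-] := dv x.
Qed.

Lemma smooth_pderivs a u : smooth u -> smooth (pderivs a u).
Proof. by move=> su; elim: a => //= i a; exact: smooth_pderiv. Qed.

Lemma smooth_Ck k u O : smooth u -> Ck k O u.
Proof.
move=> su a _ x _; have sa := smooth_pderivs a su.
split; first exact: smooth_continuous.
by move=> _ i; have [v _ dv] := smooth_is_derive i sa; have [] := dv x.
Qed.

End smooth.

(** * Functions of class C^k and integration by parts *)

Section Ck_theory.
Context {R : realType} {n : nat}.
Implicit Types (u v : 'rV[R]_n -> R) (O : set 'rV[R]_n) (a : seq 'I_n).

Lemma pderivs_rcons a i u : pderivs (rcons a i) u = pderivs a (pderiv i u).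
Proof. exact: foldr_rcons. Qed.

Lemma Ck_continuous k O u x : Ck k O u -> O x -> {for x, continuous u}.
Proof. by move=> cu Ox; have [] := cu [::] isT x Ox. Qed.

Lemma Ck_le k j O u : (j <= k)%N -> Ck k O u -> Ck j O u.
Proof.
move=> jk cu a aj x Ox; have [] := cu a (leq_trans aj jk) x Ox.
by split => // /leq_trans /(_ jk).
Qed.

Lemma Ck_sub k O O' u : O' `<=` O -> Ck k O u -> Ck k O' u.
Proof. by move=> OO' cu a ak x /OO'; exact: cu. Qed.

Lemma Ck_pderiv k O u i : Ck k.+1 O u -> Ck k O (pderiv i u).
Proof.
move=> cu a ak x Ox; rewrite -pderivs_rcons.
have sa : size (rcons a i) = (size a).+1 by rewrite size_rcons.
have [? h] := cu (rcons a i) ltac:(by rewrite sa) x Ox.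
by split => // ak' j; apply: h; rewrite sa.
Qed.

Lemma Ck_pderivs k O u a : Ck (size a + k) O u -> Ck k O (pderivs a u).
Proof.
elim/last_ind: a u => // a i IH u; rewrite size_rcons addSn pderivs_rcons.
by move/Ck_pderiv/IH.
Qed.

Lemma Ck_is_derive k O u i x : Ck k.+1 O u -> O x ->
  is_derive x (delta_mx 0 i : 'rV[R]_n) u (pderiv i u x).
Proof.
by move=> cu Ox; have [_ /(_ isT i)] := cu [::] isT x Ox; exact: derivableP.
Qed.

Lemma near_open O (P : 'rV[R]_n -> Prop) x : open O -> O x ->
  (forall y, O y -> P y) -> \forall y \near nbhs x, P y.
Proof. by move=> oO Ox OP; apply: filterS OP _; exact: open_nbhs_nbhs. Qed.

Lemma near_eq_continuous u v x : (\forall y \near nbhs x, u y = v y) ->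
  {for x, continuous u} -> {for x, continuous v}.
Proof.
move=> uv cu; have uvx : u x = v x by exact: nbhs_singleton uv.
move=> B /=; rewrite -uvx => /cu uB.
by apply: filterS (filterI uv uB) => y [/= <-].
Qed.

Lemma pderivs_lin k O u v (c : R) a : open O -> Ck k O u -> Ck k O v ->
  (size a <= k)%N -> forall x, O x ->
  pderivs a (fun x => u x + c * v x) x = pderivs a u x + c * pderivs a v x.
Proof.
move=> oO cu cv; elim: a => //= i a IH ak x Ox.
have [_ /(_ ak i)/derivableP du] := cu a (ltnW ak) x Ox.
have [_ /(_ ak i)/derivableP dv] := cv a (ltnW ak) x Ox.
have dw : is_derive x (delta_mx 0 i : 'rV[R]_n)
    (fun x => pderivs a u x + c * pderivs a v x)
    (pderiv i (pderivs a u) x + c * pderiv i (pderivs a v) x).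
  exact: (is_deriveD du (is_deriveZ c dv)).
rewrite {1}/pderiv; transitivity ('D_(delta_mx 0 i) (fun x => pderivs a u x + c * pderivs a v x) x).
  by apply: near_eq_derive; apply: (near_open oO Ox) => y; exact: IH (ltnW ak) _.
by have [_ ->] := dw.
Qed.

Lemma Ck_lin k O u v (c : R) : open O -> Ck k O u -> Ck k O v ->
  Ck k O (fun x => u x + c * v x).
Proof.
move=> oO cu cv a ak x Ox.
have [ca da] := cu a ak x Ox; have [cb db] := cv a ak x Ox.
have E : \forall y \near nbhs x, pderivs a u y + c * pderivs a v y =
    pderivs a (fun x => u x + c * v x) y.
  by apply: (near_open oO Ox) => y Oy; rewrite (pderivs_lin c oO cu cv).
split.
  apply: near_eq_continuous E _; apply: (@continuousD _ _ _ (pderivs a u)) => //.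
  by apply: (@continuousM _ _ (fun=> c)) => //; exact: cst_continuous.
move=> ak' i; apply: near_eq_derivable E _.
by apply: derivableD; [exact: da|apply: derivableZ; exact: db].
Qed.

End Ck_theory.

Section weak.
Context {R : realType} {n : nat}.
Implicit Types (u v eta : 'rV[R]_n -> R) (O K : set 'rV[R]_n) (a : seq 'I_n).
Local Notation leb := (lebesgue_rV R n).

(** The product of a function on O with a test function, extended by 0, is as
    regular as on O: it is locally that product near O and locally 0 off the
    support. *)
Lemma extend0_near_in O u x : open O -> O x -> \forall y \near nbhs x, u y = (u \_ O) y.
Proof. by move=> oO Ox; apply: (near_open oO Ox) => y Oy; rewrite patchE mem_set. Qed.

Lemma extend0_near_out O K u x : closed K -> (forall y, O y -> ~ K y -> u y = 0) ->
  ~ K x -> \forall y \near nbhs x, 0 = (u \_ O) y.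
Proof.
move=> /closed_openC oK u0 Kx; apply: near_open oK Kx _ => y Ky.
by rewrite patchE; case: ifPn => // /set_mem Oy; rewrite u0.
Qed.

Lemma continuous_extend0 O K u : open O -> closed K -> K `<=` O ->
  (forall y, O y -> {for y, continuous u}) ->
  (forall y, O y -> ~ K y -> u y = 0) -> continuous (u \_ O).
Proof.
move=> oO cK KO cu u0 x; have [Kx|Kx] := pselect (K x).
  apply: near_eq_continuous (extend0_near_in u oO (KO _ Kx)) _.
  exact: cu (KO _ Kx).
apply: (@near_eq_continuous _ _ (fun=> 0)); last exact: cst_continuous.
exact: extend0_near_out cK u0 Kx.
Qed.

Lemma is_derive_extend0 O K u (du : 'rV[R]_n -> R) (e : 'rV[R]_n) : open O ->
  closed K -> K `<=` O -> (forall y, O y -> is_derive y e u (du y)) ->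
  (forall y, O y -> ~ K y -> u y = 0) -> (forall y, O y -> ~ K y -> du y = 0) ->
  forall x, is_derive x e (u \_ O) ((du \_ O) x).
Proof.
move=> oO cK KO hu u0 du0 x; have [Kx|Kx] := pselect (K x).
  have Ox := KO _ Kx; apply: near_eq_is_derive (extend0_near_in u oO Ox) _.
  by rewrite patchE mem_set//; exact: hu.
rewrite -(nbhs_singleton (extend0_near_out cK du0 Kx)).
exact: near_eq_is_derive (extend0_near_out cK u0 Kx) _.
Qed.

Lemma compact_rV_closed K : compact K -> closed K.
Proof. exact: compact_closed (@norm_hausdorff _ _). Qed.

Lemma extend0_integrable O K u : open O -> compact K -> K `<=` O ->
  (forall y, O y -> {for y, continuous u}) ->
  (forall y, O y -> ~ K y -> u y = 0) -> leb.-integrable O (EFin \o u).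
Proof.
move=> oO cK KO cu u0; have mO := open_rV_measurable oO.
apply/(integrable_mkcond _ mO); rewrite restrict_EFin.
apply: (@compact_support_integrable _ _ K) => //.
  by apply: continuous_extend0 cu u0 => //; exact: compact_rV_closed.
move=> x Kx; rewrite patchE; case: ifPn => // /set_mem Ox; exact: u0.
Qed.

Lemma integration_by_parts_rV O K u eta i : open O -> compact K -> K `<=` O ->
  Ck 1 O u -> Ck 1 setT eta -> (forall x, ~ K x -> eta x = 0) ->
  \int[leb]_(x in O) (u x * pderiv i eta x) =
  - \int[leb]_(x in O) (pderiv i u x * eta x).
Proof.
move=> oO cK KO cu ce eta0; have clK := compact_rV_closed cK.
have de x : is_derive x (delta_mx 0 i : 'rV[R]_n) eta (pderiv i eta x).
  exact: Ck_is_derive ce _.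
have deta0 x : ~ K x -> pderiv i eta x = 0 by exact: derive_out_support clK eta0 de _.
have cue x : O x -> {for x, continuous (fun y => u y * pderiv i eta y)}.
  move=> Ox; apply: continuousM; first exact: Ck_continuous cu Ox.
  exact: Ck_continuous (Ck_pderiv i ce) I.
have cdue x : O x -> {for x, continuous (fun y => pderiv i u y * eta y)}.
  move=> Ox; apply: continuousM; first exact: Ck_continuous (Ck_pderiv i cu) Ox.
  exact: Ck_continuous ce I.
have ue0 x : O x -> ~ K x -> u x * pderiv i eta x = 0.
  by move=> _ Kx; rewrite deta0 ?mulr0.
have due0 x : O x -> ~ K x -> pderiv i u x * eta x = 0.
  by move=> _ Kx; rewrite eta0 ?mulr0.
apply/eqP; rewrite -subr_eq0 opprK -RintegralD//; last 3 first.
- exact: open_rV_measurable.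
- exact: extend0_integrable cK KO cue ue0.
- exact: extend0_integrable cK KO cdue due0.
rewrite Rintegral_mkcond /Rintegral.
have [M M0 KM] := bounded_sub_box (compact_bounded cK).
suff -> : (\int[leb]_x
    (((fun x => u x * pderiv i eta x + pderiv i u x * eta x)%R \_ O) x)%:E)%E = 0%E by [].
apply: (@integral_partial_eq0 _ _ i ((fun x => u x * eta x) \_ O) _ M) => //.
- apply: (is_derive_extend0 oO clK KO).
  + move=> x Ox; apply: (is_derive_eq (is_deriveM (Ck_is_derive i cu Ox) (de x))).
    by rewrite -![_ *: _]/(_ * _) [eta x * _]mulrC.
  + by move=> x _ Kx; rewrite eta0 ?mulr0.
  + by move=> x Ox Kx; rewrite ue0 ?due0 ?addr0.
- apply: (continuous_extend0 oO clK KO).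
  + by move=> x Ox; apply: continuousD; [exact: cue|exact: cdue].
  + by move=> x Ox Kx; rewrite ue0 ?due0 ?addr0.
- move=> x [j xj]; have Kx : ~ K x.
    by move=> /KM /(_ j); rewrite !mxE -ltr_norml ltNge (ltW xj).
  by rewrite patchE eta0 // mulr0 if_same.
Qed.

(** Each integration by parts peels off the outermost derivative of the test
    function and applies it innermost to [u]; hence the reversal. *)
Lemma integration_by_parts_pderivs O K a u eta : open O -> compact K -> K `<=` O ->
  Ck (size a) O u -> (forall k, Ck k setT eta) -> (forall x, ~ K x -> eta x = 0) ->
  \int[leb]_(x in O) (u x * pderivs a eta x) =
  (-1) ^+ size a * \int[leb]_(x in O) (pderivs (rev a) u x * eta x).
Proof.
move=> oO cK KO cu ce eta0.
have sup b x : ~ K x -> pderivs b eta x = 0.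
  elim: b x => //= i b IH; apply: derive_out_support (compact_rV_closed cK) IH _ => x.
  by apply: (@Ck_is_derive _ _ 0 setT) => //; apply: Ck_pderivs; exact: ce.
elim: a u cu => [|i a IH] u cu /=; first by rewrite expr0 mul1r.
rewrite (integration_by_parts_rV i oO cK KO); last first.
- exact: sup.
- by apply: Ck_pderivs; exact: ce.
- exact: Ck_le cu.
rewrite IH; last exact: Ck_pderiv.
by rewrite rev_cons pderivs_rcons exprS mulN1r mulNr.
Qed.

Lemma continuous_loc_integrable O u : open O ->
  (forall x, O x -> {for x, continuous u}) -> loc_integrable O u.
Proof.
move=> oO cu; have mu := continuous_rV_measurable oO cu; split=> // K cK KO.
apply: continuous_compact_integrable => //.
  exact: measurable_funS (open_rV_measurable oO) KO mu.
by move=> x /KO; exact: cu.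
Qed.

Lemma is_weak_deriv_Ck k O a u : open O -> (size a <= k)%N -> Ck k O u ->
  is_weak_deriv O a u (pderivs (rev a) u).
Proof.
move=> oO ak cu; split.
- by apply: continuous_loc_integrable => // x; exact: Ck_continuous cu.
- apply: continuous_loc_integrable => // x Ox.
  by have [] := cu (rev a) ltac:(by rewrite size_rev) x Ox.
- move=> phi [cphi [K [cK KO phi0]]].
  exact: integration_by_parts_pderivs cK KO (Ck_le ak cu) cphi phi0.
Qed.

End weak.

(** * Bump functions and the fundamental lemma *)

Section bump.
Context {R : realType} {n : nat}.
Implicit Types (a b x : 'rV[R]_n) (O K : set 'rV[R]_n).

Lemma flat_gt0 m (t : R) : 0 < t -> 0 < flat m t.
Proof. by move=> t0; rewrite /flat t0 mulr_gt0 ?exprn_gt0 ?invr_gt0 ?expR_gt0. Qed.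

Lemma flat0_le1 (t : R) : flat 0 t <= 1.
Proof. by have := flat_le 0 t; rewrite expr0. Qed.

Lemma flat0_cvgy (T : nat -> R) : T @ \oo --> +oo ->
  (fun k => flat 0 (T k)) @ \oo --> (1 : R).
Proof.
move=> Ty; have T0 : \forall k \near \oo, 0 < T k by move/cvgryPgt : Ty => /(_ 0).
apply: (@squeeze_cvgr _ _ _ _ (fun k => 1 - (T k)^-1) (fun=> 1)).
- by apply: filterS T0 => k k0; rewrite flat0_ge// flat0_le1.
- rewrite -[X in _ --> X]subr0; apply: cvgB; first exact: cvg_cst.
  exact/(gtr0_cvgV0 T0).
- exact: cvg_cst.
Qed.

Lemma flatS_cvgy m (T : nat -> R) : T @ \oo --> +oo ->
  (fun k => flat m.+1 (T k)) @ \oo --> (0 : R).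
Proof.
move=> Ty; have T0 : \forall k \near \oo, 0 < T k by move/cvgryPgt : Ty => /(_ 0).
apply: (@squeeze_cvgr _ _ _ _ (fun=> 0) (fun k => m%:R ^+ m * (T k)^-1)).
- by apply: filterS T0 => k k0; rewrite flat_ge0 flatS_le.
- exact: cvg_cst.
- rewrite -[X in _ --> X](mulr0 (m%:R ^+ m)); apply: cvgMl_tmp.
  exact/(gtr0_cvgV0 T0).
Qed.

Lemma cvg_affiney (p c : R) : 0 < p -> (fun k : nat => k.+1%:R * p + c) @ \oo --> +oo.
Proof.
move=> p0; apply/cvgryPge => A; near=> k.
rewrite -lerBlDr -ler_pdivrMr//; apply: (@le_trans _ _ k%:R); last by rewrite ler_nat.
by near: k; exact: nbhs_infty_ger.
Unshelve. all: by end_near. Qed.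

Lemma flat0_cvg (p : R) : 0 <= p ->
  (fun k : nat => flat 0 (k.+1%:R * p : R)) @ \oo --> ((0 < p)%R%:R : R).
Proof.
rewrite le_eqVlt => /predU1P[<-|p0].
  by under eq_fun do rewrite mulr0 flatN//; rewrite ltxx; exact: cvg_cst.
rewrite p0; apply: flat0_cvgy.
by under eq_fun do rewrite -[_ * p]addr0; exact: cvg_affiney.
Qed.

Lemma smooth_prod (s : seq 'I_n) (F : 'I_n -> 'rV[R]_n -> R) :
  (forall i, smooth (F i)) -> smooth (fun x => \prod_(i <- s) F i x).
Proof.
move=> sF; elim: s => [|i s IH].
  rewrite (_ : (fun x => _) = fun=> 1); first exact: smooth_cst.
  by apply/funext => x; rewrite big_nil.
rewrite (_ : (fun x => _) = fun x => F i x * \prod_(j <- s) F j x).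
  exact: smoothM.
by apply/funext => x; rewrite big_cons.
Qed.

Lemma smoothB u v : @smooth R n u -> smooth v -> smooth (fun x => u x - v x).
Proof.
move=> su sv; rewrite (_ : (fun x => _) = fun x => u x + (-1) * v x).
  by apply: smoothD => //; apply: smoothM => //; exact: smooth_cst.
by apply/funext => x; rewrite mulN1r.
Qed.

(** Smooth, and positive exactly on the open box. *)
Definition box_weight a b x : R :=
  \prod_(i < n) (flat 0 (x 0 i - a 0 i) * flat 0 (b 0 i - x 0 i)).

Lemma smooth_box_weight a b : smooth (box_weight a b).
Proof.
apply: smooth_prod => i; apply: smoothM; apply: smooth_flat; apply: smoothB.
- exact: smooth_coord.
- exact: smooth_cst.
- exact: smooth_cst.
- exact: smooth_coord.
Qed.

Lemma box_weight_ge0 a b x : 0 <= box_weight a b x.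
Proof. by apply: prodr_ge0 => i _; rewrite mulr_ge0// flat_ge0. Qed.

Lemma box_weight_gt0 a b x : (0 < box_weight a b x) <-> box a b x.
Proof.
split => [|h]; last first.
  apply: prodr_gt0 => i _; have /andP[ax xb] := h i.
  by rewrite mulr_gt0 ?flat_gt0 ?subr_gt0.
rewrite lt_neqAle eq_sym box_weight_ge0 andbT => /prodf_neq0 h i.
have := h i isT; rewrite mulf_eq0 negb_or => /andP[h1 h2]; apply/andP; split.
  by rewrite -subr_gt0 ltNge; apply: contra h1 => /flatN ->.
by rewrite -subr_gt0 ltNge; apply: contra h2 => /flatN ->.
Qed.

Lemma smooth_test_function O K u : smooth u -> compact K -> K `<=` O ->
  (forall x, ~ K x -> u x = 0) -> test_function O u.
Proof. by move=> su cK KO u0; split; [move=> k; exact: smooth_Ck|exists K]. Qed.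

Lemma box_sub_cbox a b : box a b `<=` cbox a b.
Proof. by move=> x h i; have /andP[/ltW-> /ltW->] := h i. Qed.

Local Notation leb := (lebesgue_rV R n).

(** With p the weight of the box, flat 0 (k * p) tends to the indicator of the
    open box as k grows. *)
Lemma integral_box_eq0 O v a b : open O -> loc_integrable O v ->
  (forall phi, test_function O phi -> \int[leb]_(x in O) (v x * phi x) = 0) ->
  cbox a b `<=` O -> (\int[leb]_(x in box a b) (v x)%:E = 0)%E.
Proof.
move=> oO [mv iv] v0 abO.
have cC : compact (cbox a b) by exact: compact_cbox.
have mC := compact_rV_measurable cC.
have mO := open_rV_measurable oO.
have mvC : measurable_fun (cbox a b) v by exact: measurable_funS mO abO mv.
have ivC := iv _ cC abO.
pose phi k x := flat 0 (k.+1%:R * box_weight a b x : R).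
have sphi k : smooth (phi k).
  by apply: smooth_flat; apply: smoothM; [exact: smooth_cst|exact: smooth_box_weight].
have phi0 k x : ~ box a b x -> phi k x = 0.
  move=> xab; rewrite /phi flatN// mulr_ge0_le0// leNgt.
  by apply/negP => /box_weight_gt0.
have mphi k : measurable_fun (cbox a b) (phi k).
  apply: measurable_funTS; apply: continuous_rV_measurable => [|x _]; first exact: openT.
  exact: smooth_continuous.
have int0 k : (\int[leb]_(x in cbox a b) (v x * phi k x)%:E = 0)%E.
  have tphi : test_function O (phi k).
    apply: (@smooth_test_function O (cbox a b)) => // x xab.
    by apply: phi0 => /box_sub_cbox.
  have := v0 _ tphi; rewrite Rintegral_mkcond.
  have -> : (fun x => v x * phi k x) \_ O = (fun x => v x * phi k x) \_ (cbox a b).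
    apply/funext => x; rewrite !patchE; case: ifPn => [/set_mem Ox|/negP xO].
      case: ifPn => // /negP xab; rewrite phi0 ?mulr0// => /box_sub_cbox h.
      by apply: xab; rewrite inE.
    by case: ifPn => // /set_mem/abO Ox; case: xO; rewrite inE.
  rewrite -Rintegral_mkcond => h.
  rewrite -[LHS]fineK ?[X in X%:E]h//; apply: integrable_fin_num => //.
  apply: (le_integrable mC _ _ ivC).
    by apply/measurable_EFinP; apply: measurable_funM.
  move=> x _; rewrite /= lee_fin normrM ler_piMr// ger0_norm ?flat_ge0//.
  exact: flat0_le1.
have cvg0 : (fun k => \int[leb]_(x in cbox a b) (v x * phi k x)%:E)%E @ \oo -->
    (\int[leb]_(x in cbox a b) (v x * (0 < box_weight a b x)%R%:R)%:E)%E.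
  apply: (@dominated_cvg _ _ R leb (cbox a b) mC _ _ (fun x => `|v x|%:E)) => //.
  - by move=> k; apply/measurable_EFinP; apply: measurable_funM.
  - move=> x _; apply: cvg_EFin; first by apply: nearW.
    by apply: cvgMr; apply: flat0_cvg; exact: box_weight_ge0.
  - exact: integrable_abse ivC.
  - move=> k x _; rewrite /= lee_fin normrM ler_piMr// ger0_norm ?flat_ge0//.
    exact: flat0_le1.
have E0 : (\int[leb]_(x in cbox a b) (v x * (0 < box_weight a b x)%R%:R)%:E = 0)%E.
  rewrite -(cvg_lim _ cvg0)//; apply: cvg_lim => //.
  by under eq_fun do rewrite int0; exact: cvg_cst.
rewrite -[RHS]E0 integral_mkcond [RHS]integral_mkcond; congr (integral _ _ _).
apply/funext => x; rewrite !patchE; case: ifPn => [/set_mem xab|/negP xab].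
  rewrite mem_set; last exact: box_sub_cbox.
  by move/box_weight_gt0 : xab => ->; rewrite mulr1.
case: ifPn => // _; case: ltP => [/box_weight_gt0 h|_]; last by rewrite mulr0.
by case: xab; rewrite inE.
Qed.

Definition boxes : set (set 'rV[R]_n) := [set B | exists a b, B = box a b].

Definition box_capl (a c : 'rV[R]_n) : 'rV[R]_n := \row_i Num.max (a 0 i) (c 0 i).
Definition box_capr (b d : 'rV[R]_n) : 'rV[R]_n := \row_i Num.min (b 0 i) (d 0 i).

Lemma box_setI a b c d : box a b `&` box c d = box (box_capl a c) (box_capr b d).
Proof.
apply/seteqP; split => x /=.
  move=> [h1 h2] i; rewrite !mxE gt_max lt_min.
  by move: (h1 i) (h2 i) => /andP[-> ->] /andP[-> ->].
move=> h; split => i; have := h i; rewrite !mxE gt_max lt_min.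
  by move=> /andP[/andP[-> _] /andP[-> _]].
by move=> /andP[/andP[_ ->] /andP[_ ->]].
Qed.

Lemma cbox_cap_sub a b c d : cbox (box_capl a c) (box_capr b d) `<=` cbox a b.
Proof.
move=> x h i; have := h i; rewrite !mxE ge_max le_min.
by move=> /andP[/andP[-> _] /andP[-> _]].
Qed.

Lemma setI_closed_boxes : setI_closed boxes.
Proof.
move=> _ _ [a [b ->]] [c [d ->]].
by exists (box_capl a c), (box_capr b d); exact: box_setI.
Qed.

Lemma measurable_boxes : @measurable _ 'rV[R]_n `<=` <<s boxes >>.
Proof.
have open_boxes O : open O -> <<s boxes >> O.
  move=> oO; rewrite (_ : O = \bigcup_(j : 'rV[rat]_n * nat)
      (if `[< rat_box j `<=` O >] then rat_box j else set0)).
    apply: (@countable_bigcupT_measurable _ (g_sigma_algebraType boxes)) => [|j].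
      exact: countableP.
    case: ifP => _; last exact: (@measurable0 _ (g_sigma_algebraType boxes)).
    by apply: sub_sigma_algebra; do 2 eexists.
  apply/seteqP; split => [x Ox|x [j _]]; last by case: asboolP => // jO; exact: jO.
  have [j [jx jO]] := rat_box_nbhs oO Ox.
  exists j => //; case: asboolP => // -[] y yj; apply: jO.
  exact: box_sub_cbox.
apply: smallest_sub; first exact: smallest_sigma_algebra.
rewrite -bigcup_seq => _ [i _ [Y mY <-]].
have : measurable_fun [set: g_sigma_algebraType boxes] (rV_coord i).
  apply: (measurability _ (measurable_realfun.RGenOInfty.measurableE R)) => //.
  move=> _ [_ [r ->] <-]; rewrite setTI; apply: open_boxes.
  apply: open_comp => [x _|]; [exact: coord_continuous|exact: interval_open].
by move=> /(_ measurableT Y mY).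
Qed.

(** The fundamental lemma of the calculus of variations: integrals over small
    boxes vanish, hence integrals over all small measurable sets. *)
Lemma ae_eq0_test O v : open O -> loc_integrable O v ->
  (forall phi, test_function O phi -> \int[leb]_(x in O) (v x * phi x) = 0) ->
  {ae leb, forall x, O x -> v x = 0}.
Proof.
move=> oO lv v0.
have local a b : cbox a b `<=` O -> {ae leb, forall x, box a b x -> v x = 0}.
  move=> abO; have [_ iv] := lv.
  have mQ := measurable_box a b.
  have ivQ : leb.-integrable (box a b) (EFin \o v).
    apply: integrableS (iv _ (@compact_cbox _ _ a b) abO) => //.
      by apply: compact_rV_measurable; exact: compact_cbox.
    exact: box_sub_cbox.
  have ivE E : measurable E -> leb.-integrable (E `&` box a b) (EFin \o v).
    move=> mE; apply: integrableS ivQ => //; exact: measurableI.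
  pose H := [set E : set 'rV[R]_n | measurable E /\
    (\int[leb]_(x in E `&` box a b) (v x)%:E = 0)%E].
  have Q0 : (\int[leb]_(x in box a b) (v x)%:E = 0)%E by exact: integral_box_eq0 v0 abO.
  have dH : dynkin H.
    split.
    - by split; [exact: measurableT|rewrite setTI].
    - move=> E [mE E0]; split; first exact: measurableC.
      move: Q0; rewrite (_ : box a b = (~` E `&` box a b) `|` (E `&` box a b)); last first.
        by rewrite -setIUl setUCl setTI.
      rewrite integral_setU.
      + by rewrite -setIUl setUCl setTI E0 adde0.
      + by apply: measurableI => //; exact: measurableC.
      + exact: measurableI.
      + by rewrite -setIUl setUCl setTI; case/integrableP : ivQ.
      + by apply/disj_setPS => x [[nE _] [? _]].
    - move=> F tF HF; have mF k : measurable (F k) by have [] := HF k.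
      have mU : measurable (\bigcup_k F k) by exact: bigcupT_measurable.
      split => //; rewrite setI_bigcupl integral_bigcup.
      + by apply: eseries0 => i _ _; have [] := HF i.
      + exact: trivIset_setIr.
      + by move=> k; exact: measurableI.
      + by rewrite -setI_bigcupl; exact: ivE.
  have sH : @measurable _ 'rV[R]_n `<=` H.
    apply: subset_trans measurable_boxes _.
    rewrite -(setI_closed_g_dynkin_g_sigma_algebra setI_closed_boxes).
    apply: smallest_sub => // _ [c [d ->]]; split; first exact: measurable_box.
    rewrite setIC box_setI; apply: (integral_box_eq0 oO lv v0).
    exact: subset_trans (@cbox_cap_sub _ _ _ _) abO.
  have : ae_eq leb (box a b) (EFin \o v) (cst 0%E).
    apply: integral_ae_eq => // E EQ mE.
    rewrite integral_cst// mul0e; have [_] := sH E mE.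
    by rewrite setIidl.
  by apply: filterS => x h /h [].
pose T := ('rV[rat]_n * nat)%type.
pose inO (j : T) := cbox (rat_lo j) (rat_hi j) `<=` O.
pose Q k : set 'rV[R]_n := [set x | exists j : T, [/\ unpickle k = Some j, inO j & rat_box j x]].
have aeQ k : {ae leb, forall x, Q k x -> v x = 0}.
  have [[j [kj jO]]|nj] := pselect (exists j : T, unpickle k = Some j /\ inO j).
    have := local _ _ jO; apply: filterS => x jx [j' [kj' _ j'x]].
    by apply: jx; move: kj'; rewrite kj => -[jj']; rewrite jj'.
  by apply: aeW => x [j [kj jO _]]; case: nj; exists j.
have := ae_foralln aeQ; apply: filterS => x Qv Ox.
have [j [jx jO]] := rat_box_nbhs oO Ox.
by apply: (Qv (pickle j)); exists j; split => //; exact: pickleK.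
Qed.

Lemma test_function_continuous O phi : test_function O phi -> continuous phi.
Proof. by move=> [cphi _] x; exact: (Ck_continuous (cphi 0%N)). Qed.

Lemma integrableM_test O v phi : open O -> loc_integrable O v ->
  test_function O phi -> leb.-integrable O (EFin \o (fun x => v x * phi x)).
Proof.
move=> oO [mv iv] tphi; have cphi := test_function_continuous tphi.
have [_ [K [cK KO phi0]]] := tphi.
have mO := open_rV_measurable oO; have mK := compact_rV_measurable cK.
have E : (fun x => v x * phi x) \_ O = (fun x => v x * phi x) \_ K.
  apply/funext => x; rewrite !patchE; case: ifPn => [/set_mem Ox|/negP xO].
    by case: ifPn => // /negP xK; rewrite phi0 ?mulr0// => h; apply: xK; rewrite inE.
  by case: ifPn => // /set_mem/KO Ox; case: xO; rewrite inE.
apply/(integrable_mkcond _ mO); rewrite restrict_EFin E -restrict_EFin.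
apply/(integrable_mkcond _ mK).
have [C [_ phiC]] := continuous_compact_bounded (fun x (_ : K x) => cphi x) cK.
apply: (le_integrable mK _ _ (integrableZl mK (`|C| + 1) (iv K cK KO))).
  apply/measurable_EFinP; apply: measurable_funM.
    exact: measurable_funS mO KO mv.
  apply: measurable_funTS; apply: continuous_rV_measurable => [|x _]; last exact: cphi.
  exact: openT.
move=> x Kx; rewrite /= lee_fin !normrM mulrC ler_wpM2r//.
rewrite [X in _ <= X]ger0_norm ?addr_ge0//; apply: (phiC _ _ x Kx).
by rewrite (le_lt_trans (ler_norm _))// ltrDl.
Qed.

Lemma loc_integrable_lin O v w (c : R) : open O -> loc_integrable O v ->
  loc_integrable O w -> loc_integrable O (fun x => v x + c * w x).
Proof.
move=> oO [mv iv] [mw iw]; split.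
  by apply: measurable_funD => //; apply: measurable_funM => //; exact: measurable_cst.
move=> K cK KO; have mK := compact_rV_measurable cK.
exact: (integrableD mK (iv K cK KO) (integrableZl mK c (iw K cK KO))).
Qed.

Lemma Rintegral_test_lin O v w (c : R) phi : open O -> loc_integrable O v ->
  loc_integrable O w -> test_function O phi ->
  \int[leb]_(x in O) ((v x + c * w x) * phi x) =
  \int[leb]_(x in O) (v x * phi x) + c * \int[leb]_(x in O) (w x * phi x).
Proof.
move=> oO lv lw tphi; have mO := open_rV_measurable oO.
have iv := integrableM_test oO lv tphi; have iw := integrableM_test oO lw tphi.
rewrite -RintegralZl// -RintegralD//; last exact: (integrableZl mO c iw).
by apply: eq_Rintegral => x _; rewrite mulrDl mulrA.
Qed.

End bump.

Section weak_deriv_theory.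
Context {R : realType} {n : nat}.
Implicit Types (O : set 'rV[R]_n) (a : seq 'I_n) (u v w : 'rV[R]_n -> R).
Local Notation leb := (lebesgue_rV R n).

Lemma weak_deriv_unique O a u v w : open O -> is_weak_deriv O a u v ->
  is_weak_deriv O a u w -> {ae leb, forall x, O x -> v x = w x}.
Proof.
move=> oO [_ lv v0] [_ lw w0].
have : {ae leb, forall x, O x -> v x + (-1) * w x = 0}.
  apply: ae_eq0_test => // [|phi tphi]; first exact: loc_integrable_lin.
  rewrite Rintegral_test_lin// mulN1r; apply/eqP; rewrite subr_eq0; apply/eqP.
  apply: (@mulfI _ ((-1) ^+ size a)); first by rewrite signr_eq0.
  by rewrite -v0// -w0.
by apply: filterS => x h Ox; apply/eqP; rewrite -subr_eq0 -mulN1r h.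
Qed.

Lemma is_weak_deriv_lin O a u u' v v' (c : R) : open O ->
  is_weak_deriv O a u v -> is_weak_deriv O a u' v' ->
  is_weak_deriv O a (fun x => u x + c * u' x) (fun x => v x + c * v' x).
Proof.
move=> oO [lu lv uv] [lu' lv' uv']; split; [exact: loc_integrable_lin..|].
move=> phi tphi.
have tdphi : test_function O (pderivs a phi).
  have [cphi [K [cK KO phi0]]] := tphi; split.
    by move=> k; apply: Ck_pderivs; exact: cphi.
  exists K; split => //.
  elim: (a) => //= i b IH; apply: derive_out_support (compact_rV_closed cK) IH _ => x.
  by apply: (@Ck_is_derive _ _ 0 setT) => //; apply: Ck_pderivs; exact: cphi.
by rewrite !Rintegral_test_lin// uv// uv'// mulrDr mulrCA.
Qed.

Lemma weak_derivE_ae O a u v : open O -> is_weak_deriv O a u v ->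
  {ae leb, forall x, O x -> weak_deriv O a u x = v x}.
Proof.
by move=> oO uv; apply: weak_deriv_unique (uv) => //; apply: getPex; exists v.
Qed.

Lemma weak_deriv_Ck_ae k O a u : open O -> (size a <= k)%N -> Ck k O u ->
  {ae leb, forall x, O x -> weak_deriv O a u x = pderivs (rev a) u x}.
Proof. by move=> oO ak cu; apply: weak_derivE_ae => //; exact: is_weak_deriv_Ck cu. Qed.

End weak_deriv_theory.

(** * Lp bounds and a criterion for W^{2,p}_0 *)

Section Lp_bounds.
Context {R : realType} {n : nat}.
Implicit Types (D : set 'rV[R]_n) (f : 'rV[R]_n -> R).
Local Notation leb := (lebesgue_rV R n).

Lemma measurable_extend0 D f : measurable D -> measurable_fun D f ->
  measurable_fun [set: 'rV[R]_n] (f \_ D).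
Proof. by move=> mD mf; apply/(measurable_restrictT _ mD). Qed.

Lemma Lnorm_ae_eq (p : R) (f g : 'rV[R]_n -> R) :
  measurable_fun [set: 'rV[R]_n] f -> measurable_fun [set: 'rV[R]_n] g ->
  {ae leb, forall x, f x = g x} ->
  ('N[leb]_p%:E[EFin \o f] = 'N[leb]_p%:E[EFin \o g])%E.
Proof.
move=> mf mg fg; rewrite unlock; congr (_ `^ _)%E.
apply: ge0_ae_eq_integral => //.
- apply: (measurableT_comp (measurable_poweR p)); apply: measurableT_comp => //.
  exact/measurable_EFinP.
- apply: (measurableT_comp (measurable_poweR p)); apply: measurableT_comp => //.
  exact/measurable_EFinP.
- by move=> x _; exact: poweR_ge0.
- by move=> x _; exact: poweR_ge0.
- by apply: filterS fg => x /= ->.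
Qed.

(** Since |f|^p <= C^(p-1) |f|, the L1 norm controls all others for bounded
    functions. *)
Lemma le_integral_powR D f (C p : R) : measurable D -> 1 < p -> 0 <= C ->
  measurable_fun [set: 'rV[R]_n] f ->
  (forall x, `|f x| <= C) ->
  (\int[leb]_x `|(f x)%:E| `^ p <= (C `^ (p - 1))%:E * \int[leb]_x `|(f x)%:E|)%E.
Proof.
move=> mD p1 C0 mf fC; have mEf : measurable_fun [set: 'rV[R]_n] (EFin \o f) by exact/measurable_EFinP.
rewrite -ge0_integralZl//; first last.
- by rewrite lee_fin powR_ge0.
- exact: measurableT_comp.
apply: ge0_le_integral => //.
- by move=> x _; exact: poweR_ge0.
- by apply: (measurableT_comp (measurable_poweR p)); exact: measurableT_comp.
- by apply: measurable_funeM; exact: measurableT_comp.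
move=> x _ /=; rewrite lee_fin.
rewrite -(mulr_powRB1 (normr_ge0 (f x)) (lt_trans ltr01 p1)) mulrC.
by rewrite ler_wpM2r// ge0_ler_powR// ?nnegrE// subr_ge0 ltW.
Qed.

Lemma bounded_integral_lty D f (C : R) : measurable D -> (leb D < +oo)%E ->
  measurable_fun [set: 'rV[R]_n] f -> (forall x, `|f x| <= C) ->
  (forall x, ~ D x -> f x = 0) -> (\int[leb]_x `|(f x)%:E| < +oo)%E.
Proof.
move=> mD Doo mf fC f0.
have : leb.-integrable setT (EFin \o f).
  rewrite -(restrict_support f0) -restrict_EFin.
  apply/(integrable_mkcond _ mD); apply: measurable_bounded_integrable => //.
    exact: measurable_funTS.
  exists C; split; first exact: num_real.
  by move=> M CM x _; rewrite /= (le_trans (fC x))// ltW.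
by move=> /integrableP[_].
Qed.

Lemma bounded_Lfun D f (C p : R) : measurable D -> (leb D < +oo)%E -> 1 < p -> 0 <= C ->
  measurable_fun [set: 'rV[R]_n] f -> (forall x, `|f x| <= C) ->
  (forall x, ~ D x -> f x = 0) -> f \in Lfun leb p%:E.
Proof.
move=> mD Doo p1 C0 mf fC f0; rewrite inE; apply/andP; split; first by rewrite inE.
rewrite inE /= /finite_norm unlock poweR_lty//.
apply: (le_lt_trans (le_integral_powR mD p1 C0 mf fC)).
by rewrite lte_mul_pinfty// ?lee_fin ?powR_ge0//; exact: bounded_integral_lty f0.
Qed.

Lemma bounded_Lfun_oo f (C : R) : 0 <= C ->
  measurable_fun [set: 'rV[R]_n] f -> (forall x, `|f x| <= C) -> f \in Lfun leb +oo%E.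
Proof.
move=> C0 mf fC; rewrite inE; apply/andP; split; first by rewrite inE.
rewrite inE /= /finite_norm unlock; case: ifP => // _.
apply: (@le_lt_trans _ _ C%:E); last exact: ltry.
by apply/ess_supP; apply: aeW => x /=; rewrite lee_fin.
Qed.

Lemma Lnorm_cvg0 D (f : nat -> 'rV[R]_n -> R) (C p : R) :
  measurable D -> (leb D < +oo)%E -> 1 < p -> 0 <= C ->
  (forall k, measurable_fun [set: 'rV[R]_n] (f k)) ->
  (forall k x, `|f k x| <= C) -> (forall k x, ~ D x -> f k x = 0) ->
  (forall x, D x -> (fun k => f k x) @ \oo --> (0 : R)) ->
  forall e : R, 0 < e -> \forall k \near \oo, ('N[leb]_p%:E[EFin \o f k] < e%:E)%E.
Proof.
move=> mD Doo p1 C0 mf fC f0 f_cvg e e0.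
have p0 : 0 < p by exact: lt_trans p1.
have int_cvg : (fun k => \int[leb]_(x in D) `|(f k x)%:E|)%E @ \oo --> 0%E.
  rewrite -(integral0 leb D).
  apply: (@dominated_cvg _ _ R leb D mD _ _ (fun x => C%:E)) => //.
  - move=> k; apply: measurable_funTS; apply: measurableT_comp => //.
    exact/measurable_EFinP.
  - move=> x Dx; apply: cvg_EFin; first by apply: nearW.
    by rewrite /= -[X in _ --> X](@normr0 _ R); apply: cvg_norm; exact: f_cvg.
  - apply: measurable_bounded_integrable => //.
    exists C; split; first exact: num_real.
    by move=> M CM x _; rewrite /= ger0_norm// ltW.
  - by move=> k x _; rewrite abse_id lee_fin.
pose d := e `^ p / (C `^ (p - 1) + 1).
have Cp : 0 <= C `^ (p - 1) by exact: powR_ge0.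
have ep : 0 < e `^ p by exact: powR_gt0.
have d0 : 0 < d by rewrite divr_gt0// ltr_wpDl.
have : \forall k \near \oo, (\int[leb]_(x in D) `|(f k x)%:E| < d%:E)%E.
  move/fine_cvgP : int_cvg => [fin_int /cvgr_lt/(_ d d0)].
  apply: filterS2 fin_int => k fin_k; rewrite /= -lte_fin fineK//.
apply: filterS => k kd.
have kd' : (\int[leb]_x `|(f k x)%:E| < d%:E)%E.
  apply: le_lt_trans kd; rewrite [leRHS]integral_mkcond le_eqVlt; apply/orP; left.
  apply/eqP; congr (integral _ _ _); apply/funext => x; rewrite patchE.
  by case: ifPn => // /negP xD; rewrite f0 ?abse0// => Dx; apply: xD; rewrite inE.
have lt_int : (\int[leb]_x `|(f k x)%:E| `^ p < (e `^ p)%:E)%E.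
  apply: (le_lt_trans (le_integral_powR mD p1 C0 (mf k) (fC k))).
  apply: (@le_lt_trans _ _ ((C `^ (p - 1))%:E * d%:E)%E).
    by apply: lee_pmul => //; [exact: integral_ge0|exact: ltW].
  rewrite -EFinM lte_fin /d mulrCA gtr_pMr// -ltr_pdivlMr ?invr_gt0 ?ltr_wpDl//.
  by rewrite invrK mul1r ltrDl.
rewrite ltNge; apply/negP => eN; move: lt_int; apply/negP; rewrite -leNgt.
rewrite -(poweR_Lnorm _ _ (lt0r_neq0 p0)) -poweR_EFin.
apply: gt0_ler_poweR => //; first exact: ltW.
  by rewrite in_itv/= leey andbT lee_fin ltW.
by rewrite in_itv/= leey andbT Lnorm_ge0.
Qed.

End Lp_bounds.

Section sobolev_Ck.
Context {R : realType} {n : nat}.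
Implicit Types (O : set 'rV[R]_n) (u v f phi : 'rV[R]_n -> R) (a : seq 'I_n).
Local Notation leb := (lebesgue_rV R n).

Definition bounded_on O (f : 'rV[R]_n -> R) : Prop :=
  exists C : R, forall x, O x -> `|f x| <= C.

Lemma bounded_extend0 O f (C : R) : (forall x, O x -> `|f x| <= C) ->
  forall x, `|(f \_ O) x| <= `|C|.
Proof.
move=> fC x; rewrite patchE; case: ifPn => [/set_mem/fC|_].
  by move=> /le_trans; apply; exact: ler_norm.
by rewrite normr0.
Qed.

Lemma in_Lp_bounded O f (p : R) : measurable O -> (leb O < +oo)%E -> 1 < p ->
  measurable_fun O f -> bounded_on O f -> in_Lp p%:E O f.
Proof.
move=> mO Ooo p1 mf [C fC].
apply: (@bounded_Lfun _ _ O _ `|C|) => //.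
- exact: measurable_extend0.
- exact: bounded_extend0.
- by move=> x Ox; rewrite patchE memNset.
Qed.

Lemma in_Loo_bounded O f : measurable O ->
  measurable_fun O f -> bounded_on O f -> in_Lp +oo%E O f.
Proof.
move=> mO mf [C fC]; apply: (@bounded_Lfun_oo _ _ _ `|C|) => //.
  exact: measurable_extend0.
exact: bounded_extend0.
Qed.

Section criterion.
Variables (O : set 'rV[R]_n) (u : 'rV[R]_n -> R).
Hypotheses (oO : open O) (Ooo : (leb O < +oo)%E) (cu : Ck 2 O u).
Hypothesis bu : forall a, (size a <= 2)%N -> bounded_on O (pderivs a u).

Let mO : measurable O. Proof. exact: open_rV_measurable. Qed.

Lemma Ck_pderivs_measurable k v a : Ck k O v -> (size a <= k)%N ->
  measurable_fun O (pderivs a v).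
Proof.
move=> cv ak; apply: continuous_rV_measurable => // x Ox.
by have [] := cv a ak x Ox.
Qed.

Lemma Ck_W2oo : W2oo O u.
Proof.
split; first by apply: in_Loo_bounded => //; [exact: (@Ck_pderivs_measurable _ u [::] cu)|exact: (bu (a := [::]))].
move=> a a2; exists (pderivs (rev a) u); first exact: is_weak_deriv_Ck cu.
have ra2 : (size (rev a) <= 2)%N by rewrite size_rev.
by apply: in_Loo_bounded => //; [exact: Ck_pderivs_measurable cu ra2|exact: bu].
Qed.

Lemma Ck_sobolev (p : R) : 1 < p -> sobolev 2 p%:E O u.
Proof.
move=> p1; split; first by apply: in_Lp_bounded => //; [exact: (@Ck_pderivs_measurable _ u [::] cu)|exact: (bu (a := [::]))].
move=> a a2; exists (pderivs (rev a) u); first exact: is_weak_deriv_Ck cu.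
have ra2 : (size (rev a) <= 2)%N by rewrite size_rev.
by apply: in_Lp_bounded => //; [exact: Ck_pderivs_measurable cu ra2|exact: bu].
Qed.

(** Classical derivatives that stay bounded and converge pointwise converge in
    every Lp with p finite; this reaches functions whose second derivatives
    jump across the boundary. *)
Lemma Ck_sobolev0 (p : R) (phi : nat -> 'rV[R]_n -> R) : 1 < p ->
  (forall k, test_function O (phi k)) ->
  (forall a, (size a <= 2)%N -> exists C : R, forall k x, O x ->
     `|pderivs a (phi k) x| <= C) ->
  (forall a x, (size a <= 2)%N -> O x ->
     (fun k => pderivs a (phi k) x) @ \oo --> pderivs a u x) ->
  sobolev0 2 p%:E O u.
Proof.
move=> p1 tphi bphi cvg_phi; split => [|e e0]; first exact: Ck_sobolev.
pose N := \sum_(m < 3) \sum_(a : m.-tuple 'I_n) (1 : R).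
have N0 : 0 <= N by apply: sumr_ge0 => m _; apply: sumr_ge0.
pose d := e / (N + 1).
have d0 : 0 < d by rewrite divr_gt0// ltr_wpDl.
have cphi k : Ck 2 O (phi k).
  by apply: (@Ck_sub _ _ _ setT) => //; have [] := tphi k.
pose w k := (u \- phi k)%R.
have wE k : w k = (fun x => u x + (-1) * phi k x).
  by apply/funext => x; rewrite mulN1r.
have cw k : Ck 2 O (w k) by rewrite wE; exact: Ck_lin.
have dwE k a x : (size a <= 2)%N -> O x ->
    pderivs a (w k) x = pderivs a u x - pderivs a (phi k) x.
  by move=> a2 Ox; rewrite wE (pderivs_lin _ oO cu (cphi k))// mulN1r.
have small : \forall k \near \oo, forall (m : 'I_3) (a : m.-tuple 'I_n),
    ('N[leb]_p%:E[EFin \o (weak_deriv O a (w k) \_ O)] < d%:E)%E.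
  apply: filter_forall => m; apply: filter_forall => a.
  have a2 : (size a <= 2)%N by rewrite size_tuple -ltnS.
  have ra2 : (size (rev a) <= 2)%N by rewrite size_rev.
  have [C1 bu1] := bu ra2; have [C2 bphi2] := bphi _ ra2.
  have mdw k : measurable_fun O (pderivs (rev a) (w k)).
    exact: Ck_pderivs_measurable (cw k) ra2.
  have mx k : measurable_fun [set: 'rV[R]_n] (pderivs (rev a) (w k) \_ O).
    exact: measurable_extend0.
  have : \forall k \near \oo,
      ('N[leb]_p%:E[EFin \o (pderivs (rev a) (w k) \_ O)] < d%:E)%E.
    apply: (@Lnorm_cvg0 R n O (fun k => pderivs (rev a) (w k) \_ O) `|C1 + C2| p) => //.
    - move=> k x; apply: bounded_extend0 => y Oy; rewrite dwE//.
      by rewrite (le_trans (ler_normB _ _))// lerD// ?bu1// bphi2.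
    - by move=> k x Ox; rewrite patchE memNset.
    - move=> x Ox; rewrite (_ : (fun k => _) =
        fun k => pderivs (rev a) u x - pderivs (rev a) (phi k) x); last first.
        by apply/funext => k; rewrite patchE mem_set// dwE.
      rewrite -[X in _ --> X](subrr (pderivs (rev a) u x)).
      by apply: cvgB; [exact: cvg_cst|exact: cvg_phi].
  apply: filterS => k; rewrite (@Lnorm_ae_eq _ _ _ (weak_deriv O a (w k) \_ O)
    (pderivs (rev a) (w k) \_ O))//.
    apply: measurable_extend0 => //.
    have : is_weak_deriv O a (w k) (weak_deriv O a (w k)).
      by apply: getPex; exists (pderivs (rev a) (w k)); exact: is_weak_deriv_Ck (cw k).
    by case=> _ [].
  have := weak_deriv_Ck_ae oO a2 (cw k); apply: filterS => x h.
  by rewrite !patchE; case: ifPn => // /set_mem/h.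
have [k sk] := filter_ex small; exists (phi k) => //.
apply: (@le_lt_trans _ _ (N * d)%:E); last first.
  rewrite lte_fin /d mulrCA gtr_pMr// ltr_pdivrMr ?ltr_wpDl// mul1r.
  by rewrite ltrDl.
rewrite /sobolev_norm /N mulr_suml -sumEFin; apply: lee_sum => m _.
rewrite mulr_suml -sumEFin; apply: lee_sum => a _.
by rewrite mul1r; apply/ltW; exact: sk.
Qed.

End criterion.
End sobolev_Ck.

(** * The square of a defining function *)

Section defining_function.
Context {R : realType} {n : nat}.
Local Notation leb := (lebesgue_rV R n).
Implicit Types (x v : 'rV[R]_n).

Lemma is_derive_mul (f g : 'rV[R]_n -> R) x v a b : is_derive x v f a ->
  is_derive x v g b -> is_derive x v (fun y => f y * g y) (a * g x + f x * b).
Proof.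
move=> df dg; apply: (is_derive_eq (is_deriveM df dg)).
by rewrite -![_ *: _]/(_ * _) addrC mulrC.
Qed.

Lemma is_derive_add (f g : 'rV[R]_n -> R) x v a b : is_derive x v f a ->
  is_derive x v g b -> is_derive x v (fun y => f y + g y) (a + b).
Proof. exact: is_deriveD. Qed.

Lemma is_derive_cmul (f : 'rV[R]_n -> R) x v (c a : R) : is_derive x v f a ->
  is_derive x v (fun y => c * f y) (c * a).
Proof. exact: is_deriveZ. Qed.

Lemma is_derive_addc (f : 'rV[R]_n -> R) x v (c a : R) : is_derive x v f a ->
  is_derive x v (fun y => f y + c) a.
Proof.
move=> df; apply: (is_derive_eq (is_derive_add df (is_derive_cst c x v))).
exact: addr0.
Qed.

Lemma pderivE i (f df : 'rV[R]_n -> R) :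
  (forall x, is_derive x (delta_mx 0 i : 'rV[R]_n) f (df x)) -> pderiv i f = df.
Proof. by move=> h; apply/funext => x; have [_ <-] := h x. Qed.

Lemma smooth_pderivP i (f : 'rV[R]_n -> R) x : smooth f ->
  is_derive x (delta_mx 0 i : 'rV[R]_n) f (pderiv i f x).
Proof. by move=> /(smooth_Ck (k := 1) (O := setT)) cf; exact: Ck_is_derive cf _. Qed.

Variables (theta : 'rV[R]_n -> R) (c : R).
Hypotheses (smooth_theta : smooth theta)
  (compact_theta : compact [set x | 0 <= theta x]).

Let O := [set x | 0 < theta x].
Let tau k x : R := k.+1%:R * theta x - 1.
(** With e = 1/(k+1), this is c e^2 G(theta/e - 1) for G(s) = s^2 exp(-1/s): it is
    supported in theta >= e, and G'' is bounded with limit 2 at infinity. *)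
Let phi k x := c * ((theta x - k.+1%:R^-1) * (theta x - k.+1%:R^-1) * flat 0 (tau k x)).
Let phi1 i k x := c * ((2 * theta x - k.+1%:R^-1) * flat 0 (tau k x) * pderiv i theta x).
Let phi2 j i k x := c * ((2 * flat 0 (tau k x) + 2 * flat 1 (tau k x) + flat 2 (tau k x)) *
    pderiv j theta x * pderiv i theta x +
  (2 * theta x - k.+1%:R^-1) * flat 0 (tau k x) * pderiv j (pderiv i theta) x).

Let is_derive_tau i k x :
  is_derive x (delta_mx 0 i : 'rV[R]_n) (tau k) (k.+1%:R * pderiv i theta x).
Proof. by apply: is_derive_addc; apply: is_derive_cmul; exact: smooth_pderivP. Qed.

Let is_derive_flat_tau i k x : is_derive x (delta_mx 0 i : 'rV[R]_n)
  (fun y => flat 0 (tau k y)) (flat 2 (tau k x) * (k.+1%:R * pderiv i theta x)).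
Proof.
apply: (@is_derive_compR _ _ (flat 0)); last exact: is_derive_tau.
by apply: (is_derive_eq (flat_is_derive 0 _)); rewrite mul0r subr0.
Qed.

Let thetaE k x : theta x = (tau k x + 1) / k.+1%:R.
Proof. by rewrite /tau subrK mulrC mulKf. Qed.

Let pderiv_phi i k : pderiv i (phi k) = phi1 i k.
Proof.
apply: pderivE => x.
have dt := is_derive_addc (- k.+1%:R^-1) (smooth_pderivP i x smooth_theta).
apply: (is_derive_eq (is_derive_cmul c (is_derive_mul (is_derive_mul dt dt)
  (is_derive_flat_tau i k x)))).
rewrite /phi1 (thetaE k x) (flatS 0) (flatS 1).
have k0 : k.+1%:R != 0 :> R by [].
by move: (flat 2 (tau k x)) (tau k x) (pderiv i theta x) (k.+1%:R : R) k0 => E s t K K0; field.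
Qed.

Let pderiv2_phi j i k : pderiv j (pderiv i (phi k)) = phi2 j i k.
Proof.
rewrite pderiv_phi; apply: pderivE => x.
have d2t := is_derive_addc (- k.+1%:R^-1) (is_derive_cmul 2 (smooth_pderivP j x smooth_theta)).
have dit := smooth_pderivP j x (smooth_pderiv i smooth_theta).
apply: (is_derive_eq (is_derive_cmul c (is_derive_mul (is_derive_mul d2t
  (is_derive_flat_tau j k x)) dit))).
rewrite /phi2 (thetaE k x) (flatS 0) (flatS 1).
have k0 : k.+1%:R != 0 :> R by [].
by move: (flat 2 (tau k x)) (tau k x) (pderiv j (pderiv i theta) x) (pderiv i theta x) (pderiv j theta x) (k.+1%:R : R) k0 => E s t t' t'' K K0; field.
Qed.

Let u x := c * (theta x * theta x).

Lemma pderiv_sqr i : pderiv i u = fun x => c * (2 * theta x * pderiv i theta x).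
Proof.
apply: pderivE => x; have dt := smooth_pderivP i x smooth_theta.
apply: (is_derive_eq (is_derive_cmul c (is_derive_mul dt dt))); ring.
Qed.

Lemma pderiv2_sqr j i : pderiv j (pderiv i u) = fun x =>
  c * (2 * pderiv j theta x * pderiv i theta x + 2 * theta x * pderiv j (pderiv i theta) x).
Proof.
rewrite pderiv_sqr; apply: pderivE => x.
apply: is_derive_cmul; apply: is_derive_mul.
  by apply: is_derive_cmul; exact: smooth_pderivP.
by apply: smooth_pderivP; exact: smooth_pderiv.
Qed.

Let smooth_sqr : smooth u.
Proof. by apply: smoothM; [exact: smooth_cst|exact: smoothM]. Qed.

Let smooth_phi k : smooth (phi k).
Proof.
have st : smooth (fun x => theta x - k.+1%:R^-1).
  by apply: smoothB => //; exact: smooth_cst.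
apply: smoothM; first exact: smooth_cst.
apply: smoothM; first exact: smoothM.
apply: smooth_flat; apply: smoothB; last exact: smooth_cst.
by apply: smoothM => //; exact: smooth_cst.
Qed.

Lemma open_positivity : open O.
Proof.
have := smooth_continuous smooth_theta.
rewrite (_ : O = theta @^-1` [set t | 0 < t])// => cth.
by apply: open_comp => [x _|]; [exact: cth|exact: open_gt].
Qed.

Lemma lebesgue_positivity_lty : (leb O < +oo)%E.
Proof.
apply: (@le_lt_trans _ _ (leb [set x | 0 <= theta x])).
  apply: le_measure; rewrite ?inE.
  - by apply: open_rV_measurable; exact: open_positivity.
  - exact: compact_rV_measurable.
  - by move=> x; rewrite /O /=; exact: ltW.
exact: lebesgue_rV_compact.
Qed.

Let test_phi k : test_function O (phi k).
Proof.
apply: (@smooth_test_function _ _ _ [set x | k.+1%:R^-1 <= theta x]) => //.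
- apply: (subclosed_compact _ compact_theta).
    rewrite (_ : [set x | _] = theta @^-1` [set t | k.+1%:R^-1 <= t])//.
    apply: preimage_closed; last exact: closed_ge.
    by move=> x _; exact: smooth_continuous.
  by move=> x /=; apply: le_trans.
- by move=> x; rewrite /O /=; apply: lt_le_trans.
- move=> x /negP; rewrite -ltNge => tk.
  rewrite /phi flatN ?mulr0// /tau subr_le0 mulrC -ler_pdivlMr// mul1r.
  exact: ltW.
Qed.

Let ubounded (f : nat -> 'rV[R]_n -> R) :=
  exists C : R, forall k x, O x -> `|f k x| <= C.

Let ubounded_smooth f : smooth f -> ubounded (fun=> f).
Proof.
move=> sf.
have [C [_ fC]] := continuous_compact_bounded
  (fun x _ => smooth_continuous sf (x := x)) compact_theta.
exists (`|C| + 1) => k x Ox; apply: (fC _ _ x (ltW Ox)).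
by rewrite (le_lt_trans (ler_norm _))// ltrDl.
Qed.

Let uboundedD f g : ubounded f -> ubounded g -> ubounded (fun k x => f k x + g k x).
Proof.
move=> [C fC] [D gD]; exists (C + D) => k x Ox.
by rewrite (le_trans (ler_normD _ _))// lerD ?fC ?gD.
Qed.

Let uboundedM f g : ubounded f -> ubounded g -> ubounded (fun k x => f k x * g k x).
Proof.
move=> [C fC] [D gD]; exists (C * D) => k x Ox.
by rewrite normrM ler_pM// ?fC ?gD.
Qed.

Let uboundedc (a : R) : ubounded (fun _ _ => a).
Proof. by exists `|a|. Qed.

Let ubounded_flat m : ubounded (fun k x => flat m (tau k x)).
Proof. by exists (m%:R ^+ m) => k x _; rewrite ger0_norm ?flat_ge0// flat_le. Qed.

Let ubounded_inv : ubounded (fun k _ => - k.+1%:R^-1).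
Proof. by exists 1 => k x _; rewrite normrN ger0_norm// invf_le1// ler1n. Qed.

Let cvg_inv : (fun k : nat => k.+1%:R^-1 : R) @ \oo --> (0 : R).
Proof. exact: cvg_harmonic. Qed.

Let cvg_flat0 x : O x -> (fun k => flat 0 (tau k x)) @ \oo --> (1 : R).
Proof. by move=> Ox; apply: flat0_cvgy; exact: cvg_affiney. Qed.

Let cvg_flatS m x : O x -> (fun k => flat m.+1 (tau k x)) @ \oo --> (0 : R).
Proof. by move=> Ox; apply: flatS_cvgy; exact: cvg_affiney. Qed.

Let seq_le2 (a : seq 'I_n) : (size a <= 2)%N ->
  [\/ a = [::], exists i, a = [:: i] | exists j i, a = [:: j; i]].
Proof.
case: a => [|i [|j [|//]]] _; [by constructor 1|by constructor 2; exists i|].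
by constructor 3; exists i, j.
Qed.

Let ubounded_pderivs a : (size a <= 2)%N -> ubounded (fun k => pderivs a (phi k)).
Proof.
have st i : ubounded (fun=> pderiv i theta) by apply: ubounded_smooth; exact: smooth_pderiv.
have stt j i : ubounded (fun=> pderiv j (pderiv i theta)).
  by apply: ubounded_smooth; do 2 apply: smooth_pderiv.
have s0 := ubounded_smooth smooth_theta.
move=> /seq_le2[->|[i ->]|[j [i ->]]] /=.
- rewrite /phi; apply: uboundedM => //; apply: uboundedM => //.
  by apply: uboundedM; apply: uboundedD.
- under [X in ubounded X]eq_fun do rewrite pderiv_phi.
  by rewrite /phi1; do 3 (apply: uboundedM => //); apply: uboundedD => //; apply: uboundedM.
- under [X in ubounded X]eq_fun do rewrite pderiv2_phi.
  rewrite /phi2; apply: uboundedM => //; apply: uboundedD.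
    do 2 (apply: uboundedM => //); apply: uboundedD => //; apply: uboundedD => //;
    exact: uboundedM.
  by do 2 (apply: uboundedM => //); apply: uboundedD => //; apply: uboundedM.
Qed.

Let cvg_pderivs a x : (size a <= 2)%N -> O x ->
  (fun k => pderivs a (phi k) x) @ \oo --> pderivs a u x.
Proof.
move=> /seq_le2 ha Ox; have c0 := cvg_flat0 Ox; have cS m := cvg_flatS m Ox.
have ce : (fun k : nat => theta x - k.+1%:R^-1) @ \oo --> theta x - 0.
  by apply: cvgB; [exact: cvg_cst|exact: cvg_inv].
have c2e : (fun k : nat => 2 * theta x - k.+1%:R^-1) @ \oo --> 2 * theta x - 0.
  by apply: cvgB; [exact: cvg_cst|exact: cvg_inv].
case: ha => [->|[i ->]|[j [i ->]]] /=.
- rewrite (_ : u x = c * ((theta x - 0) * (theta x - 0) * 1)); last by rewrite mulr1 subr0.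
  by apply: cvgMl_tmp; apply: cvgM => //; exact: cvgM.
- under eq_fun do rewrite pderiv_phi; rewrite pderiv_sqr.
  rewrite (_ : _ * _ = c * ((2 * theta x - 0) * 1 * pderiv i theta x)); last first.
    by rewrite mulr1 subr0.
  by apply: cvgMl_tmp; apply: cvgMr_tmp; exact: cvgM.
- under eq_fun do rewrite pderiv2_phi; rewrite pderiv2_sqr.
  rewrite (_ : _ * _ = c * ((2 * 1 + 2 * 0 + 0) * pderiv j theta x * pderiv i theta x +
    (2 * theta x - 0) * 1 * pderiv j (pderiv i theta) x)); last by ring.
  apply: cvgMl_tmp; apply: cvgD; last by apply: cvgMr_tmp; exact: cvgM.
  do 2 apply: cvgMr_tmp; apply: cvgD => //; apply: cvgD; apply: cvgMl_tmp => //.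
Qed.

(** The square of a defining function vanishes to second order on the boundary,
    but its Hessian does not. *)
Lemma W2oo_0_sqr : W2oo_0 O u.
Proof.
have oO := open_positivity; have Ooo := lebesgue_positivity_lty.
have cu : Ck 2 O u by exact: smooth_Ck.
have bu a : (size a <= 2)%N -> bounded_on O (pderivs a u).
  move=> _; have [C hC] := ubounded_smooth (smooth_pderivs a smooth_sqr).
  by exists C => x; exact: (hC 0%N).
split; first exact: Ck_W2oo.
by move=> p p1; exact: (Ck_sobolev0 oO Ooo cu bu p1 test_phi ubounded_pderivs cvg_pderivs).
Qed.

End defining_function.

(** * The operator A : D^2 u *)

Section elliptic_operator.
Context {R : realType} {n : nat}.
Implicit Types (x : 'rV[R]_n) (u v : 'rV[R]_n -> R) (O : set 'rV[R]_n).
Local Notation leb := (lebesgue_rV R n).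

Lemma is_derive_bigsum (I : Type) (s : seq I) (F : I -> 'rV[R]_n -> R) (d : I -> R)
    (x e : 'rV[R]_n) : (forall i, is_derive x e (F i) (d i)) ->
  is_derive x e (fun y => \sum_(i <- s) F i y) (\sum_(i <- s) d i).
Proof.
move=> dF; elim: s => [|i s IH].
  rewrite big_nil (_ : (fun y => _) = cst 0); first exact: is_derive_cst.
  by apply/funext => y; rewrite big_nil.
rewrite big_cons (_ : (fun y => _) = fun y => F i y + \sum_(j <- s) F j y).
  exact: is_derive_add.
by apply/funext => y; rewrite big_cons.
Qed.

Lemma continuous_bigsum (I : Type) (s : seq I) (F : I -> 'rV[R]_n -> R) x :
  (forall i, {for x, continuous (F i)}) ->
  {for x, continuous (fun y => \sum_(i <- s) F i y)}.
Proof.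
move=> cF; elim: s => [|i s IH].
  rewrite (_ : (fun y => _) = fun=> 0); first exact: cst_continuous.
  by apply/funext => y; rewrite big_nil.
rewrite (_ : (fun y => _) = fun y => F i y + \sum_(j <- s) F j y).
  exact: (@continuousD _ _ _ (F i)).
by apply/funext => y; rewrite big_cons.
Qed.

Lemma smooth_sum (I : Type) (s : seq I) (F : I -> 'rV[R]_n -> R) :
  (forall i, smooth (F i)) -> smooth (fun x => \sum_(i <- s) F i x).
Proof.
move=> sF; elim: s => [|i s IH].
  rewrite (_ : (fun x => _) = fun=> 0); first exact: smooth_cst.
  by apply/funext => x; rewrite big_nil.
rewrite (_ : (fun x => _) = fun x => F i x + \sum_(j <- s) F j x).
  exact: smoothD.
by apply/funext => x; rewrite big_cons.
Qed.

Variable A : 'M[R]_n.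

Definition Lop u x : R := mxdot A (hessian u x).

Definition dLop u k x : R := \sum_i \sum_j A i j * pderivs [:: k; i; j] u x.

Lemma LopE u x : Lop u x = \sum_i \sum_j A i j * pderivs [:: i; j] u x.
Proof. by apply: eq_bigr => i _; apply: eq_bigr => j _; rewrite mxE. Qed.

Lemma Lop_continuous O u x : Ck 2 O u -> O x -> {for x, continuous (Lop u)}.
Proof.
move=> cu Ox; rewrite (funext (LopE u)).
apply: continuous_bigsum => i; apply: continuous_bigsum => j.
apply: (@continuousM _ _ (fun=> _)); first exact: cst_continuous.
by have [] := cu [:: i; j] isT x Ox.
Qed.

Lemma dLop_continuous O u k x : Ck 3 O u -> O x -> {for x, continuous (dLop u k)}.
Proof.
move=> cu Ox; apply: continuous_bigsum => i; apply: continuous_bigsum => j.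
apply: (@continuousM _ _ (fun=> _)); first exact: cst_continuous.
by have [] := cu [:: k; i; j] isT x Ox.
Qed.

Lemma Lop_is_derive O u k x : Ck 3 O u -> O x ->
  is_derive x (delta_mx 0 k : 'rV[R]_n) (Lop u) (dLop u k x).
Proof.
move=> cu Ox; rewrite (funext (LopE u)).
apply: is_derive_bigsum => i; apply: is_derive_bigsum => j.
apply: is_derive_cmul; have [_ /(_ isT k)] := cu [:: i; j] isT x Ox.
exact: derivableP.
Qed.

Lemma Lop_lin O u v (c : R) x : open O -> Ck 2 O u -> Ck 2 O v -> O x ->
  Lop (fun x => u x + c * v x) x = Lop u x + c * Lop v x.
Proof.
move=> oO cu cv Ox; rewrite !LopE mulr_sumr -big_split; apply: eq_bigr => i _ /=.
rewrite mulr_sumr -big_split; apply: eq_bigr => j _ /=.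
have /= -> := pderivs_lin (a := [:: i; j]) c oO cu cv isT Ox.
by rewrite mulrDr mulrCA.
Qed.

Hypothesis A_pos : symmetric_posdef A.

Lemma A_sym i j : A i j = A j i.
Proof. by have [AT _] := A_pos; rewrite -[in LHS]AT mxE. Qed.

Lemma posdefE (y : 'rV[R]_n) : y != 0 -> 0 < \sum_i \sum_j A i j * (y 0 i * y 0 j).
Proof.
move=> /(proj2 A_pos); rewrite mxE exchange_big; congr (0 < _).
apply: eq_bigr => j _; rewrite !mxE mulr_suml; apply: eq_bigr => i _; ring.
Qed.

Lemma pderivs_swap_Lop u x :
  \sum_i \sum_j A i j * pderivs [:: j; i] u x = Lop u x.
Proof.
transitivity (\sum_i \sum_j A j i * pderivs [:: i; j] u x).
  exact: exchange_big.
by rewrite LopE; apply: eq_bigr => i _; apply: eq_bigr => j _; rewrite [A j i]A_sym.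
Qed.

(** Weak derivatives are matched with classical ones in the reverse order; the
    symmetry of A absorbs the transposition. *)
Lemma weak_hessian_Lop O u : open O -> Ck 2 O u ->
  {ae leb, forall x, O x -> mxdot A (weak_hessian O u x) = Lop u x}.
Proof.
move=> oO cu.
have : {ae leb, forall x, forall i j : 'I_n, O x ->
    weak_deriv O [:: i; j] u x = pderivs [:: j; i] u x}.
  apply: filter_forall => i; apply: filter_forall => j.
  exact: (weak_deriv_Ck_ae (a := [:: i; j]) oO _ cu).
apply: filterS => x h Ox; rewrite -pderivs_swap_Lop.
by apply: eq_bigr => i _; apply: eq_bigr => j _; rewrite mxE h.
Qed.

(** The sixfold contraction factors as the cube of the scalar times the
    quadratic form of A at the gradient of A : D^2 u. *)
Lemma cube_contractE (t : R) u x :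
  cube_contract (t *: A) u x =
  t ^+ 3 * \sum_i \sum_j A i j * (dLop u i x * dLop u j x).
Proof.
rewrite /cube_contract mulr_sumr; apply: eq_bigr => i _.
rewrite mulr_sumr; apply: eq_bigr => j _.
rewrite [dLop u i x]/dLop mulr_suml !mulr_sumr; apply: eq_bigr => k _.
rewrite mulr_suml !mulr_sumr; apply: eq_bigr => l _.
rewrite [dLop u j x]/dLop !mulr_sumr; apply: eq_bigr => p _.
rewrite !mulr_sumr; apply: eq_bigr => q _.
rewrite !mxE; move: (A i j) (A k l) (A p q) (pderivs [:: i; k; l] u x) (pderivs [:: j; p; q] u x).
by move=> a b c d e; ring.
Qed.

Lemma cube_contract_eq0 (t : R) u x : cube_contract (t *: A) u x = 0 ->
  forall k, t * dLop u k x = 0.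
Proof.
rewrite cube_contractE => /eqP; rewrite mulf_eq0 expf_eq0 /= => /orP[/eqP-> k|/eqP q0 k].
  by rewrite mul0r.
pose y := \row_i dLop u i x.
have [y0|/posdefE] := eqVneq y 0.
  by have /rowP/(_ k) := y0; rewrite !mxE => ->; rewrite mulr0.
rewrite (_ : \sum_i _ = 0) ?ltxx// -[RHS]q0.
by apply: eq_bigr => i _; apply: eq_bigr => j _; rewrite !mxE.
Qed.

End elliptic_operator.

(** * Functions with vanishing gradient *)

Section constancy.
Context {R : realType} {n : nat}.
Implicit Types (x y : 'rV[R]_n) (p : 'rV[R]_n -> R) (O : set 'rV[R]_n).

Lemma derive0_constant (g : R -> R) (d : R) :
  (forall s, Num.min 0 d <= s <= Num.max 0 d -> is_derive s (1 : R) g 0) ->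
  g d = g 0.
Proof.
move=> dg; have seg (a b : R) : a <= b ->
    (forall s, a <= s <= b -> is_derive s (1 : R) g 0) -> g b = g a.
  move=> ab h; have cg : {within `[a, b], continuous g}.
    apply: continuous_in_subspaceT => s; rewrite inE /= in_itv/= => /h [dgs _].
    by apply: differentiable_continuous; apply/derivable1_diffP.
  have h' : forall s, s \in `]a, b[ -> is_derive s (1 : R) g ((fun=> 0) s).
    by move=> s; rewrite in_itv/= => /andP[/ltW as_ /ltW sb]; apply: h; rewrite as_ sb.
  have [c _] := MVT_segment ab h' cg.
  by rewrite mul0r => /eqP; rewrite subr_eq0 => /eqP.
have [d0|d0] := leP 0 d.
  by apply: seg => // s; move: (dg s); rewrite min_l// max_r.
by apply/esym/seg => [|s]; [exact: ltW|move: (dg s); rewrite min_r ?max_l// ltW].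
Qed.

(** Moving one coordinate at a time stays in the ball of the sup norm. *)
Lemma partial0_ball p x (e : R) : 0 < e ->
  (forall y, ball x e y -> forall i, is_derive y (delta_mx 0 i : 'rV[R]_n) p 0) ->
  forall y, ball x e y -> p y = p x.
Proof.
move=> e0 dp y /(rV_ballE x y e0) xy.
pose z m : 'rV[R]_n := \row_(i < n) (if (i < m)%N then y 0 i else x 0 i).
have zS (i : 'I_n) : p (z i.+1) = p (z i).
  pose g (s : R) := p (s *: delta_mx 0 i + z i).
  have -> : p (z i.+1) = g (y 0 i - x 0 i).
    congr p; apply/rowP => j; rewrite !mxE eqxx/= ltnS leq_eqVlt.
    have [->|ji] := eqVneq j i; first by rewrite eqxx ltnn /= mulr1 subrK.
    by rewrite (negbTE (ji : val j != val i)) mulr0 add0r.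
  have -> : p (z i) = g 0 by rewrite /g scale0r add0r.
  apply: derive0_constant => s hs; apply: is_derive_line; apply: dp.
  apply/(rV_ballE _ _ e0) => j; rewrite !mxE eqxx/=.
  have [->|ji] := eqVneq j i.
    rewrite ltnn mulr1; apply: (le_lt_trans _ (xy i)).
    rewrite (_ : _ - _ = - s); last by ring.
    rewrite normrN distrC; move: hs; move: (_ - _) => d.
    by case: (leP 0 d) => d0 /andP[s1 s2]; rewrite ler_norml; apply/andP; split;
      [have := normr_ge0 d; lra|rewrite (le_trans s2)// ler_norm
      |rewrite lerNl -normrN (le_trans _ (ler_norm _))// lerN2
      |have := normr_ge0 d; lra].
  rewrite mulr0 add0r; case: ifP => _; first exact: xy.
  by rewrite subrr normr0.
have zE m : (m <= n)%N -> p (z m) = p x.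
  elim: m => [_|m IH mn].
    by congr p; apply/rowP => i; rewrite mxE ltn0.
  by rewrite -(IH (ltnW mn)) (zS (Ordinal mn)).
by rewrite -(zE n (leqnn n)); congr p; apply/rowP => i; rewrite mxE ltn_ord.
Qed.

Lemma partial0_connected O p : open O -> connected O ->
  (forall y, O y -> forall i, is_derive y (delta_mx 0 i : 'rV[R]_n) p 0) ->
  forall x y, O x -> O y -> p y = p x.
Proof.
move=> oO cO dp x y Ox Oy.
have open_level (Q : R -> Prop) : open [set z | O z /\ Q (p z)].
  rewrite openE => z [Oz Qz].
  have /nbhs_ballP[e /= e0 zeO] : nbhs z O by exact: open_nbhs_nbhs.
  apply/nbhs_ballP; exists e => // w zw; split; first exact: zeO.
  suff -> : p w = p z by [].
  by apply: (partial0_ball e0 _ zw) => v /zeO; exact: dp.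
suff E : [set z | O z /\ p z = p x] = O.
  by have [] : [set z | O z /\ p z = p x] y by rewrite E.
apply: cO; first by exists x.
  exists [set z | O z /\ p z = p x]; first exact: (open_level (fun t => t = p x)).
  by apply/seteqP; split => [z [Oz pz]|z [_]].
exists (~` [set z | O z /\ p z <> p x]).
  by apply: open_closedC; exact: (open_level (fun t => t <> p x)).
apply/seteqP; split => [z [Oz pz]|z [Oz pz]]; split => //; first by move=> [].
by apply: contrapT => npz; apply: pz.
Qed.

(** The range is an interval, so two distinct values would bring their midpoint
    as a third point of the level set. *)
Lemma level_le2_const (h : R -> R) (f : 'rV[R]_n -> R) O (t : R) :
  ([set s | h s = t] #<= `I_2)%card -> connected O ->
  (forall x, O x -> {for x, continuous f}) -> (forall x, O x -> h (f x) = t) ->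
  forall x y, O x -> O y -> f x = f y.
Proof.
move=> /pcard_leP[i] cO cf ht.
have lt_false x y : O x -> O y -> f x < f y -> False.
  move=> Ox Oy xy.
  have /connected_intervalP itv : connected (f @` O).
    apply: connected_continuous_connected => //; apply: continuous_in_subspaceT => z.
    by rewrite inE; exact: cf.
  pose m := (f x + f y) / 2.
  have [z Oz fz] : (f @` O) m.
    by apply: (itv (f x) (f y)); [exists x|exists y|rewrite /m; apply/andP; split; lra].
  have xm : f x < m by rewrite /m; lra.
  have my : m < f y by rewrite /m; lra.
  have lev w : O w -> [set s | h s = t] (f w) by exact: ht.
  have i2 w : O w -> (i (f w) < 2)%N by move=> Ow; exact: (@funS _ _ _ _ i _ (lev w Ow)).
  have ij w w' : O w -> O w' -> i (f w) = i (f w') -> f w = f w'.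
    by move=> Ow Ow' E; apply: (@inj _ _ _ i) => //; rewrite inE; exact: lev.
  have n1 : i (f x) <> i (f y) by move=> /(ij _ _ Ox Oy) E; rewrite E ltxx in xy.
  have n2 : i (f x) <> i (f z) by move=> /(ij _ _ Ox Oz) E; rewrite E fz ltxx in xm.
  have n3 : i (f z) <> i (f y) by move=> /(ij _ _ Oz Oy) E; rewrite -E fz ltxx in my.
  move: (i2 x Ox) (i2 y Oy) (i2 z Oz) n1 n2 n3.
  by move: (i (f x)) (i (f y)) (i (f z)) => [|[|?]] [|[|?]] [|[|?]].
move=> x y Ox Oy; have [xy|xy|//] := ltgtP (f x) (f y); exfalso.
  exact: lt_false xy.
exact: lt_false xy.
Qed.

End constancy.

(** * Absolute minimisers *)

Section round_ball.
Context {R : realType} {n : nat}.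
Implicit Types (x c : 'rV[R]_n).

Definition ball_fun c (r : R) x : R :=
  r ^+ 2 - \sum_i (x 0 i - c 0 i) * (x 0 i - c 0 i).

Lemma smooth_ball_fun c r : smooth (ball_fun c r).
Proof.
apply: smoothB; first exact: smooth_cst.
have sc i : smooth (fun x => x 0 i - c 0 i).
  by apply: smoothB; [exact: smooth_coord|exact: smooth_cst].
by apply: smooth_sum => i; exact: smoothM.
Qed.

Lemma pderiv_ball_fun c r j : pderiv j (ball_fun c r) = fun x => - 2 * (x 0 j - c 0 j).
Proof.
apply: pderivE => x.
have dc i := is_derive_addc (- c 0 i) (is_derive_coord i j x).
have := is_derive_bigsum (index_enum 'I_n) (fun i => is_derive_mul (dc i) (dc i)).
move=> /(is_deriveB (is_derive_cst (r ^+ 2) x _)) h; apply: (is_derive_eq h).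
rewrite sub0r (bigD1 j)//= eqxx big1 => [|i /negbTE ->].
  by rewrite mulr1n; ring.
by rewrite mulr0n mul0r mulr0 addr0.
Qed.

Lemma ball_fun_ge0 c r x : 0 <= r -> 0 <= ball_fun c r x ->
  forall i, `|x 0 i - c 0 i| <= r.
Proof.
move=> r0; rewrite subr_ge0 => hx i.
rewrite -(ler_pXn2r (isT : (0 < 2)%N)) ?nnegrE// real_normK ?num_real//.
apply: le_trans hx; rewrite (bigD1 i)//= expr2 lerDl; apply: sumr_ge0 => j _.
by rewrite -expr2 sqr_ge0.
Qed.

Lemma compact_ball_fun c r : 0 <= r -> compact [set x | 0 <= ball_fun c r x].
Proof.
move=> r0; apply: (@subclosed_compact _ _ (cbox (\row_i (c 0 i - r)) (\row_i (c 0 i + r)))).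
- rewrite (_ : [set x | _] = ball_fun c r @^-1` [set t | 0 <= t])//.
  apply: preimage_closed; last exact: closed_ge.
  by move=> x _; exact: smooth_continuous (smooth_ball_fun c r) x.
- exact: compact_cbox.
- move=> x /(ball_fun_ge0 r0) h i; rewrite !mxE; have := h i.
  by rewrite ler_norml => /andP[? ?]; apply/andP; split; lra.
Qed.

(** Boundary points are reached radially from inside. *)
Lemma ball_fun_closure c r x (U : set 'rV[R]_n) : 0 < r -> 0 <= ball_fun c r x ->
  nbhs x U -> exists2 y, U y & 0 < ball_fun c r y.
Proof.
move=> r0 hx /nbhs_ballP[e /= e0 eU].
pose s : R := Num.min 2^-1 (e / (2 * (r + 1))).
have s0 : 0 < s by rewrite lt_min invr_gt0 ltr0n/= divr_gt0// mulr_gt0// ltr_wpDl// ltW.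
have s1 : s < 1 by rewrite gt_min; apply/orP; left; lra.
have se : s * r < e.
  have r1 : 0 < 2 * (r + 1) by lra.
  have : s <= e / (2 * (r + 1)) by rewrite ge_min lexx orbT.
  by rewrite ler_pdivlMr// => h; have : 0 < s * r by [rewrite mulr_gt0]; nra.
exists (\row_i (x 0 i + s * (c 0 i - x 0 i))).
  apply: eU; apply/(rV_ballE _ _ e0) => i; rewrite mxE opprD addNKr normrN normrM gtr0_norm//.
  by rewrite (le_lt_trans _ se)// ler_pM2l// distrC (ball_fun_ge0 (ltW r0)).
have : (1 - s) ^+ 2 * \sum_i (x 0 i - c 0 i) * (x 0 i - c 0 i) <= (1 - s) ^+ 2 * r ^+ 2.
  by rewrite ler_wpM2l ?sqr_ge0//; move: hx; rewrite subr_ge0.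
rewrite /ball_fun subr_gt0 mulr_sumr => h; apply: (@le_lt_trans _ _ ((1 - s) ^+ 2 * r ^+ 2)).
  by apply: le_trans h; apply: ler_sum => i _; rewrite mxE; lra.
by rewrite gtr_pMl ?exprn_gt0// expr_lt1// ?subr_ge0 ?ltW//; lra.
Qed.

End round_ball.

Section comparison.
Context {R : realType} {n : nat}.
Implicit Types (x y : 'rV[R]_n).

Lemma compact_max (K : set 'rV[R]_n) (F : 'rV[R]_n -> R) : K !=set0 -> compact K ->
  (forall x, K x -> {for x, continuous F}) ->
  exists2 x, K x & forall y, K y -> F y <= F x.
Proof.
move=> K0 cK cF; have [] := @compact_EVT_max _ R F K K0 cK.
  by apply: continuous_in_subspaceT => x; rewrite inE; exact: cF.
by move=> x /set_mem Kx h; exists x => // y Ky; apply: h; rewrite inE.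
Qed.

(** Where the correction [q] is not positive, [F] stays below its maximum by a
    margin, which a small multiple of [q] cannot use up. *)
Lemma lower_max (K : set 'rV[R]_n) (F q : 'rV[R]_n -> R) (xM : 'rV[R]_n) :
  compact K -> (forall x, K x -> {for x, continuous F}) -> continuous q ->
  K xM -> (forall x, K x -> F x <= F xM) ->
  (forall x, K x -> q x <= 0 -> F x < F xM) ->
  forall k0 : R, 0 < k0 -> exists k xk : _, [/\ 0 < k, k <= k0, K xk,
    forall x, K x -> F x - k * q x <= F xk - k * q xk &
    F xk - k * q xk < F xM].
Proof.
move=> cK cF cq KM FM Fq k0 k00.
have cG (k : R) x : K x -> {for x, continuous (fun x => F x - k * q x)}.
  move=> Kx; apply: continuousB; first exact: cF.
  by apply: (@continuousM _ _ (fun=> k)); [exact: cst_continuous|exact: cq].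
have maxG k := compact_max (ex_intro _ xM KM) cK (cG k).
have [Q Q0 qQ] : exists2 Q : R, 0 < Q & forall x, K x -> `|q x| <= Q.
  have [Q [_ h]] := continuous_compact_bounded (fun x (_ : K x) => cq x) cK.
  exists (`|Q| + 1); first by rewrite ltr_wpDl.
  by move=> x Kx; apply: h => //; rewrite (le_lt_trans (ler_norm _))// ltrDl.
pose K1 := K `&` [set x | q x <= 0].
have [K1N0|K1N0] := pselect (K1 !=set0); last first.
  have [xk Kk mk] := maxG k0; exists k0, xk; split => //.
  have : 0 < q xk.
    by rewrite ltNge; apply/negP => qk; apply: K1N0; exists xk.
  by move=> qk; have := FM xk Kk; nra.
have cK1 : compact K1.
  apply: (@subclosed_compact _ _ K) => //; last by move=> x [].
  apply: closedI; first exact: compact_rV_closed.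
  rewrite (_ : [set x | _] = q @^-1` [set t | t <= 0])//.
  by apply: preimage_closed; [move=> x _; exact: cq|exact: closed_le].
have [x1 [Kx1 qx1] m1] := compact_max K1N0 cK1 (fun x (h : K1 x) => cF x h.1).
have Mm : 0 < F xM - F x1 by rewrite subr_gt0; exact: Fq.
pose k := Num.min k0 ((F xM - F x1) / (2 * Q)).
have kpos : 0 < k by rewrite lt_min k00 divr_gt0// mulr_gt0.
have kQ : k * Q < F xM - F x1.
  have : k <= (F xM - F x1) / (2 * Q) by rewrite ge_min lexx orbT.
  by rewrite ler_pdivlMr ?mulr_gt0//; have : 0 < k * Q by [rewrite mulr_gt0]; lra.
have [xk Kk mk] := maxG k; exists k, xk; split => //; first by rewrite ge_min lexx.
have [qk|qk] := ltP 0 (q xk); first by have := FM xk Kk; have : 0 < k * q xk by [rewrite mulr_gt0]; lra.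
have := m1 xk (conj Kk qk); have := qQ xk Kk; rewrite ler_norml => /andP[h _] h1.
by have : k * - q xk <= k * Q by [rewrite ler_pM2l//; lra]; lra.
Qed.

Lemma derive_neq0_not_max (O : set 'rV[R]_n) (F dF : 'rV[R]_n -> R) v x :
  open O -> O x -> (forall y, O y -> is_derive y v F (dF y)) -> dF x != 0 ->
  exists2 y, O y & F x < F y.
Proof.
move=> oO Ox hF dx; apply: contrapT => nmax.
have le_max y : O y -> F y <= F x.
  by move=> Oy; rewrite leNgt; apply/negP => xy; apply: nmax; exists y.
have cl : {for (0 : R), continuous (fun s : R => s *: v + x)}.
  by apply: cvgD; [apply: cvgZr_tmp; exact: cvg_id|exact: cvg_cst].
have nO : nbhs (0 *: v + x) O by rewrite scale0r add0r; exact: open_nbhs_nbhs.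
have /nbhs_ballP[e /= e0 eO] := cl O nO.
have sO (s : R) : s \in `](- e), e[ -> O (s *: v + x).
  rewrite in_itv/= => se; apply: eO; rewrite /ball/= sub0r normrN.
  by rewrite ltr_norml.
pose g (s : R) := F (s *: v + x).
have : is_derive (0 : R) (1 : R) g 0.
  apply: (@derive1_at_max _ g (- e) e 0).
  - by lra.
  - by move=> s /sO Os; have [] := is_derive_line (hF _ Os).
  - by rewrite in_itv/= oppr_lt0 e0.
  - by move=> s /sO Os; rewrite /g scale0r add0r; exact: le_max.
have : is_derive (0 : R) (1 : R) g (dF (0 *: v + x)).
  by apply: is_derive_line; apply: hF; apply: sO; rewrite in_itv/= oppr_lt0 e0.
rewrite scale0r add0r => d1 d2; move: dx.
by rewrite (is_derive_unique d1 d2) eqxx.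
Qed.

End comparison.

Section absolute_minimiser.
Context {R : realType} {n : nat}.
Local Notation leb := (lebesgue_rV R n).
Implicit Types (x : 'rV[R]_n) (u : 'rV[R]_n -> R) (O : set 'rV[R]_n).

Variable A : 'M[R]_n.
Hypothesis A_pos : symmetric_posdef A.

Lemma E_oo_le (h : R -> R) u O (M : R) : open O -> Ck 2 O u -> 0 <= M ->
  (E_oo (fun X => h (mxdot A X)) u O <= M%:E)%E <->
  {ae leb, forall x, O x -> `|h (Lop A u x)| <= M}.
Proof.
move=> oO cu M0; have hL := weak_hessian_Lop A_pos oO cu.
have leb0 : (0 < leb [set: 'rV[R]_n])%E by exact: (lebesgue_rV_open_gt0 (x := 0) openT).
rewrite /E_oo unlock leb0; split.
  move/ess_supP; apply: filterS2 hL => x LE + Ox.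
  by rewrite /= lee_fin patchE mem_set// LE.
move=> hM; apply/ess_supP; apply: filterS2 hL hM => x LE hM /=.
rewrite lee_fin patchE; case: ifPn => [/set_mem Ox|_]; last by rewrite normr0.
by rewrite LE// hM.
Qed.

(** On the zero set of theta only the product of first derivatives survives, and
    it is the quadratic form of A at the gradient of theta. *)
Lemma Lop_sqr_boundary (theta : 'rV[R]_n -> R) (c : R) x : smooth theta -> theta x = 0 ->
  Lop A (fun x => c * (theta x * theta x)) x =
  c * (2 * \sum_i \sum_j A i j * (pderiv i theta x * pderiv j theta x)).
Proof.
move=> st t0; rewrite LopE !mulr_sumr; apply: eq_bigr => i _.
rewrite !mulr_sumr; apply: eq_bigr => j _ /=.
rewrite pderiv2_sqr// t0 mulr0 mul0r addr0.
by move: (A i j) (pderiv i theta x) (pderiv j theta x) => a p q; ring.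
Qed.

Lemma Lop_sqr_scale (theta : 'rV[R]_n -> R) (c : R) x : smooth theta ->
  Lop A (fun x => c * (theta x * theta x)) x =
  c * Lop A (fun x => 1 * (theta x * theta x)) x.
Proof.
move=> st; rewrite !LopE !mulr_sumr; apply: eq_bigr => i _.
rewrite !mulr_sumr; apply: eq_bigr => j _ /=; rewrite !pderiv2_sqr//.
by move: (2 * _ * _ + _) (A i j) => a b; ring.
Qed.

Lemma derive_sign_mono (h : R -> R) (t0 d sg : R) : (sg = 1 \/ sg = -1) ->
  (forall t, derivable h t 1) -> (forall t, `|t - t0| < d -> 0 < sg * derive1 h t) ->
  forall s t, `|s - t0| < d -> `|t - t0| < d -> sg * s < sg * t -> h s < h t.
Proof.
move=> sgE dh hd.
have mvt s t : `|s - t0| < d -> `|t - t0| < d -> s < t -> sg * h s < sg * h t.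
  move=> sd td st.
  have ch : {within `[s, t], continuous h}.
    apply: continuous_subspaceT => y; apply: differentiable_continuous.
    exact/derivable1_diffP.
  have dh' y : y \in `]s, t[ -> is_derive y (1 : R) h (derive1 h y).
    by move=> _; rewrite derive1E; exact: derivableP.
  have [c] := MVT st dh' ch; rewrite in_itv/= => /andP[sc ct] E.
  have : 0 < sg * derive1 h c.
    apply: hd; move: sd td; rewrite !ltr_norml => /andP[? ?] /andP[? ?].
    by apply/andP; split; lra.
  by move=> h0; rewrite -subr_gt0 -mulrBr E mulrA mulr_gt0// subr_gt0.
move=> s t sd td; case: sgE mvt => -> mvt.
  by rewrite !mul1r => /(mvt s t sd td); rewrite !mul1r.
by rewrite !mulN1r ltrN2 => /(mvt t s td sd); rewrite !mulN1r ltrN2.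
Qed.

(** If the gradient of h(A : D^2 u) does not vanish at a point, h is strictly
    monotone near the value there, and on a small ball A : D^2 u or its opposite
    attains its maximum on the sphere only. The operator is positive on the
    squared defining function there, so subtracting a small multiple of that
    square lowers the maximum. *)
Lemma AM2_gradient_eq0 (Omega : set 'rV[R]_n) (h : R -> R) u : open Omega ->
  C1 h -> (forall t, 0 <= h t) -> Ck 3 Omega u ->
  AM2 (E_oo (fun X => h (mxdot A X))) Omega u ->
  forall x k, Omega x -> derive1 h (Lop A u x) * dLop A u k x = 0.
Proof.
move=> oOm [dh ch] h0 cu [_ am] x0 i0 Om0.
apply: contrapT => /eqP; rewrite mulf_eq0 negb_or => /andP[h'0 df0].
pose f := Lop A u; pose t0 := f x0.
have cu2 : Ck 2 Omega u by exact: Ck_le cu.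
(* sg is -1 when h decreases: then the minimum of f matters *)
pose sg : R := Num.sg (derive1 h t0).
have sgE : sg = 1 \/ sg = -1.
  by rewrite /sg; case: (sgrP (derive1 h t0)) => [h0'|_|_]; [move: h'0; rewrite h0' eqxx|left|right].
have sg2 : sg * sg = 1 by case: sgE => ->; rewrite ?mulrNN mulr1.
have [d d0 hd] : exists2 d : R, 0 < d & forall t, `|t - t0| < d -> 0 < sg * derive1 h t.
  have cs : {for t0, continuous (fun t => sg * derive1 h t)}.
    by apply: (@continuousM _ _ (fun=> sg)); [exact: cst_continuous|exact: ch].
  have s0 : 0 < sg * derive1 h t0 by rewrite -normrEsg normr_gt0.
  have /cs/nbhs_ballP[d /= d0 dP] : nbhs (sg * derive1 h t0) [set y | 0 < y].
    by apply: open_nbhs_nbhs; split; [exact: open_gt|].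
  by exists d => // t td; apply: dP; rewrite /ball/= distrC.
have mono := derive_sign_mono sgE dh hd.
have [e e0 he] : exists2 e : R, 0 < e & forall y, ball x0 e y ->
    [/\ Omega y, `|f y - t0| < d / 2 & dLop A u i0 y != 0].
  have n1 : nbhs x0 Omega by exact: open_nbhs_nbhs.
  have n2 : nbhs x0 (f @^-1` (ball t0 (d / 2))).
    apply: (Lop_continuous (A := A) cu2 Om0); apply: (@nbhsx_ballx _ R^o).
    by rewrite divr_gt0.
  have n3 : nbhs x0 (dLop A u i0 @^-1` [set y | y != 0]).
    by apply: (dLop_continuous (A := A) (k := i0) cu Om0); apply: open_nbhs_nbhs; split;
      [exact: open_neq|].
  have /nbhs_ballP[e /= e0 eP] : nbhs x0 (Omega `&` (f @^-1` ball t0 (d / 2) `&`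
      (dLop A u i0 @^-1` [set y | y != 0]))) by exact: filterI n1 (filterI n2 n3).
  exists e; first exact: e0.
  move=> y /eP[h1 [h2 h3]]; split; [exact: h1| |exact: h3].
  by rewrite distrC; exact: h2.
pose r := e / 2.
have r0 : 0 < r by rewrite divr_gt0.
pose theta := ball_fun x0 r.
have st : smooth theta by exact: smooth_ball_fun.
pose K := [set x | 0 <= theta x]; pose O := [set x | 0 < theta x].
have cK : compact K by exact: compact_ball_fun (ltW r0).
have OK : O `<=` K by move=> x /ltW.
have Kball x : K x -> ball x0 e x.
  move=> /(ball_fun_ge0 (ltW r0)) hx; apply/(rV_ballE _ _ e0) => i.
  by rewrite distrC (le_lt_trans (hx i))// /r; lra.
have KOm : K `<=` Omega by move=> x /Kball/he[].
have oO : open O by exact: open_positivity.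
have OOm : O `<=` Omega by exact: subset_trans OK KOm.
have cO : compactly_contained O Omega.
  have clO : closure O `<=` K.
    apply: (subset_trans (closure_subset OK)).
    by rewrite -(closure_id K).1//; exact: compact_rV_closed.
  split; last exact: subset_trans clO KOm.
  by apply: subclosed_compact cK clO; exact: closed_closure.
pose q := Lop A (fun x => 1 * (theta x * theta x)).
have cq : continuous q.
  move=> x; apply: (@Lop_continuous _ _ A setT) => //; apply: smooth_Ck.
  by apply: smoothM; [exact: smooth_cst|exact: smoothM].
have q_bd x : theta x = 0 -> 0 < q x.
  move=> tx; rewrite /q Lop_sqr_boundary// mul1r mulr_gt0//.
  rewrite (_ : \sum_i _ = 4 * \sum_i \sum_j A i j * ((x - x0) 0 i * (x - x0) 0 j)).
    rewrite mulr_gt0// posdefE//; apply/eqP => xx0; move: tx.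
    rewrite /theta /ball_fun big1 ?subr0 => [/eqP|i _].
      by rewrite expf_eq0/= (gt_eqF r0).
    by have /rowP/(_ i) := xx0; rewrite !mxE => ->; rewrite mul0r.
  rewrite mulr_sumr; apply: eq_bigr => i _; rewrite mulr_sumr; apply: eq_bigr => j _.
  by rewrite !pderiv_ball_fun !mxE; ring.
pose F x := sg * f x.
have cf x : Omega x -> {for x, continuous f} by exact: Lop_continuous.
have cF x : K x -> {for x, continuous F}.
  move=> /KOm Ox; apply: (@continuousM _ _ (fun=> sg)); first exact: cst_continuous.
  exact: cf.
have K0 : K x0.
  by rewrite /K /= /theta /ball_fun big1 ?subr0 ?sqr_ge0// => i _; rewrite subrr mul0r.
have [xM KM FM] := compact_max (ex_intro _ x0 K0) cK cF.
have interior x : O x -> F x < F xM.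
  move=> Ox; have [y Oy Fxy] : exists2 y, O y & F x < F y.
    apply: (@derive_neq0_not_max _ _ O F (fun x => sg * dLop A u i0 x) (delta_mx 0 i0)) => //.
      by move=> y Oy; apply: is_derive_cmul; exact: Lop_is_derive cu (OOm _ Oy).
    apply: mulf_neq0; first by case: sgE => ->; rewrite ?oppr_eq0 oner_eq0.
    by have [_ _ dfx] := he x (Kball _ (OK _ Ox)); exact: dfx.
  by apply: (lt_le_trans Fxy); apply: FM; exact: OK.
have Fq x : K x -> q x <= 0 -> F x < F xM.
  move=> Kx qx; apply: interior; rewrite /O /= lt_neqAle [_ <= _]Kx andbT eq_sym.
  by apply/eqP => /q_bd; rewrite ltNge qx.
have [Q Q0 qQ] : exists2 Q : R, 0 < Q & forall x, K x -> `|q x| <= Q.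
  have [Q [_ hQ]] := continuous_compact_bounded (fun x (_ : K x) => cq x) cK.
  exists (`|Q| + 1); first by rewrite ltr_wpDl.
  by move=> x Kx; apply: hQ => //; rewrite (le_lt_trans (ler_norm _))// ltrDl.
have kap0 : 0 < d / 2 / Q by rewrite !divr_gt0.
have [k [xk [k0 kQ Kk Fk FkM]]] := lower_max cK cF cq KM FM Fq kap0.
pose phi x := - (sg * k) * (theta x * theta x).
have [g gE] : exists g : 'rV[R]_n -> R, forall x, g x = f x - sg * k * q x by eexists.
have Fg x : F x - k * q x = sg * g x.
  by rewrite /F gE mulrBr mulrA mulrA sg2 mul1r.
have gd x : K x -> `|g x - t0| < d.
  move=> Kx; have [_ fd _] := he x (Kball _ Kx).
  have sgk : `|sg * k * q x| <= d / 2.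
    rewrite !normrM (_ : `|sg| = 1); last by case: sgE => ->; rewrite ?normrN normr1.
    rewrite mul1r (gtr0_norm k0); apply: (@le_trans _ _ (k * Q)).
      by rewrite ler_pM2l// qQ.
    by rewrite -ler_pdivlMr.
  rewrite gE addrAC; move: fd sgk; move: (f x - t0) (sg * k * q x) => a b fd sgk.
  by rewrite (splitr d) (le_lt_trans (ler_normB _ _))// ltr_leD.
have hk0 : 0 <= h (g xk) by exact: h0.
have cphi : Ck 2 Omega phi.
  by apply: smooth_Ck; apply: smoothM; [exact: smooth_cst|exact: smoothM].
have uphiE : (u \+ phi)%R = (fun x => u x + 1 * phi x).
  by apply/funext => x; rewrite mul1r.
have Lv x : Omega x -> Lop A (u \+ phi)%R x = g x.
  move=> Ox; rewrite uphiE (Lop_lin A 1 oOm cu2 cphi Ox) mul1r.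
  by rewrite /phi Lop_sqr_scale// mulNr gE.
have /le_trans leE := am O oO cO phi (@W2oo_0_sqr _ _ theta (- (sg * k)) st cK).
have : (E_oo (fun X => h (mxdot A X)) u O <= (h (g xk))%:E)%E.
  apply: leE; apply/E_oo_le => //.
    by rewrite uphiE; apply: Ck_lin => //; apply: Ck_sub OOm _.
  apply: aeW => x Ox; rewrite ger0_norm// Lv; last exact: OOm.
  have gx : sg * g x <= sg * g xk by rewrite -(Fg x) -(Fg xk); exact: Fk (OK _ Ox).
  have [lt|ge] := ltP (sg * g x) (sg * g xk).
    by apply/ltW; apply: mono lt; [exact: gd (OK _ Ox)|exact: gd Kk].
  have E : sg * g x = sg * g xk by apply/eqP; rewrite eq_le gx ge.
  have -> : g x = g xk by rewrite -[LHS]mul1r -sg2 -mulrA E mulrA sg2 mul1r.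
  exact: lexx.
move/(E_oo_le h oO (Ck_sub OOm cu2) hk0) => aeh.
have nbhsF x : K x -> sg * g xk < F x -> nbhs x [set y | sg * g xk < F y].
  move=> Kx Fx; have h1 : nbhs (F x) [set t | sg * g xk < t].
    by apply: open_nbhs_nbhs; split; [exact: open_gt|exact: Fx].
  exact: (cF x Kx _ h1).
pose U := O `&` [set x | sg * g xk < F x].
have oU : open U.
  rewrite openE => x [Ox Ux]; apply: filterI; first exact: open_nbhs_nbhs.
  exact: nbhsF (OK _ Ox) Ux.
have FMg : sg * g xk < F xM by rewrite -Fg.
have [x3 U3 O3] := ball_fun_closure r0 KM (nbhsF xM KM FMg).
have [y [Oy Uy] /(_ Oy)] := ae_open_witness oU (conj O3 U3 : U x3) aeh.
rewrite ger0_norm// leNgt => /negP; apply; apply: mono => //; first exact: gd.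
have [_ fd _] := he y (Kball _ (OK _ Oy)); apply: (lt_trans fd).
by rewrite [ltRHS]splitr ltrDl divr_gt0.
Qed.

End absolute_minimiser.

(** * Uniqueness for zero boundary data *)

Section L2_approximation.
Context {R : realType} {n : nat}.
Implicit Types (O : set 'rV[R]_n) (u v w f : 'rV[R]_n -> R) (a : seq 'I_n) (e : R).
Local Notation leb := (lebesgue_rV R n).

Definition int_le O f e : Prop :=
  leb.-integrable O (EFin \o f) /\ \int[leb]_(x in O) f x <= e.

Lemma int_leD O f v e e' : measurable O -> int_le O f e -> int_le O v e' ->
  int_le O (fun x => f x + v x) (e + e').
Proof.
move=> mO [fi fe] [vi ve]; split; first exact: (integrableD mO fi vi).
by rewrite RintegralD// lerD.
Qed.

Lemma int_le_sum O (I : Type) (s : seq I) (F : I -> 'rV[R]_n -> R) e : measurable O ->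
  (forall i, int_le O (F i) e) ->
  int_le O (fun x => \sum_(i <- s) F i x) (\sum_(i <- s) e).
Proof.
move=> mO Fe; elim: s => [|i s IH].
  rewrite big_nil (_ : (fun x => _) = cst 0); last first.
    by apply/funext => x; rewrite big_nil.
  by split; [exact: integrable0|rewrite Rintegral_cst// mul0r].
rewrite big_cons (_ : (fun x => _) = fun x => F i x + \sum_(j <- s) F j x).
  exact: int_leD.
by apply/funext => x; rewrite big_cons.
Qed.

Lemma int_le_sqr O f e : measurable O -> measurable_fun O f ->
  (\int[leb]_(x in O) (f x ^+ 2)%:E <= e%:E)%E -> int_le O (fun x => f x ^+ 2) e.
Proof.
move=> mO mf le_e.
have fin : leb.-integrable O (EFin \o (fun x => f x ^+ 2)).
  apply/integrableP; split.
    by apply/measurable_EFinP; exact: measurable_funX.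
  apply: le_lt_trans (ltry e); apply: le_trans le_e.
  rewrite le_eqVlt; apply/orP; left; apply/eqP; apply: eq_integral => x _ /=.
  by rewrite ger0_norm// sqr_ge0.
split => //; rewrite -lee_fin /Rintegral fineK//.
exact: integrable_fin_num.
Qed.

Lemma Lnorm2_sqr O f (e : R) : measurable O -> 0 < e ->
  ('N[leb]_2%:E[EFin \o (f \_ O)] < e%:E)%E ->
  (\int[leb]_(x in O) (f x ^+ 2)%:E <= (e ^+ 2)%:E)%E.
Proof.
move=> mO e0 fe.
have -> : (\int[leb]_(x in O) (f x ^+ 2)%:E =
    \int[leb]_x `|(EFin \o (f \_ O)) x| `^ 2)%E.
  rewrite integral_mkcond; apply: eq_integral => x _; rewrite /= !patchE.
  case: ifPn => _ /=; last by rewrite normr0 powR0.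
  by rewrite -[2%R]/(2%:R) powR_mulrn// real_normK// num_real.
rewrite -poweR_Lnorm// -(powR_mulrn 2 (ltW e0)) -poweR_EFin.
apply: gt0_ler_poweR => //; last exact: ltW.
  by rewrite in_itv/= leey andbT Lnorm_ge0.
by rewrite in_itv/= leey andbT lee_fin ltW.
Qed.

Lemma sobolev_norm_ge k p O u a : (size a <= k)%N ->
  ('N[leb]_p[EFin \o (weak_deriv O a u \_ O)] <= sobolev_norm k p O u)%E.
Proof.
move=> ak; have ak' : (size a < k.+1)%N by [].
rewrite /sobolev_norm (bigD1 (Ordinal ak'))//= (bigD1 (in_tuple a))//= -addeA.
apply: leeDl; apply: adde_ge0; last first.
  by apply: sume_ge0 => m _; apply: sume_ge0 => b _; exact: Lnorm_ge0.
by apply: sume_ge0 => b _; exact: Lnorm_ge0.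
Qed.

Lemma test_functionB O phi psi : test_function O phi -> test_function O psi ->
  test_function O (fun x => phi x + (-1) * psi x).
Proof.
move=> [cphi [K [cK KO phi0]]] [cpsi [K' [cK' KO' psi0]]]; split.
  by move=> k; apply: Ck_lin => //; exact: openT.
exists (K `|` K'); split; [exact: compactU|by move=> x [/KO|/KO']|].
by move=> x /not_orP[Kx Kx']; rewrite phi0// psi0// mulr0 addr0.
Qed.

Lemma test_function_Ck k O phi : test_function O phi -> Ck k O phi.
Proof. by move=> [cphi _]; exact: Ck_sub (cphi k). Qed.

(** The difference of approximants of u1 and u2 approximates w, and the weak
    derivatives of the error are classical because w is of class C^2. *)
Lemma approx_L2 O u1 u2 w (e : R) : open O -> sobolev0 2 2%:E O u1 ->
  sobolev0 2 2%:E O u2 -> Ck 2 O w -> (forall x, w x = u1 x + (-1) * u2 x) -> 0 < e ->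
  exists2 chi, test_function O chi & forall a, (size a <= 2)%N ->
    int_le O (fun x => pderivs a (fun x => w x + (-1) * chi x) x ^+ 2) e.
Proof.
move=> oO [[_ su1] ap1] [[_ su2] ap2] cw wE e0.
have mO := open_rV_measurable oO.
pose d := Num.min 1 (e / 4).
have d0 : 0 < d by rewrite lt_min ltr01 divr_gt0.
have d2 : d ^+ 2 <= e / 4.
  rewrite expr2; apply: (@le_trans _ _ (1 * d)); last by rewrite mul1r ge_min lexx orbT.
  by rewrite ler_wpM2r ?(ltW d0)// ge_min lexx.
have [phi tphi phid] := ap1 d d0; have [psi tpsi psid] := ap2 d d0.
have tchi := test_functionB tphi tpsi.
exists (fun x => phi x + (-1) * psi x) => // a' a2'.
pose a := rev a'; have aE : rev a = a' by rewrite revK.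
have a2 : (size a <= 2)%N by rewrite size_rev.
pose D1 := weak_deriv O a (u1 \- phi)%R; pose D2 := weak_deriv O a (u2 \- psi)%R.
have weak (u phi0 : 'rV[R]_n -> R) : (forall a, (size a <= 2)%N ->
    exists2 v, is_weak_deriv O a u v & in_Lp 2%:E O v) -> test_function O phi0 ->
    is_weak_deriv O a (fun x => u x + (-1) * phi0 x) (weak_deriv O a (u \- phi0)%R).
  move=> /(_ a a2)[v uv _] tphi0.
  have -> : (u \- phi0)%R = (fun x => u x + (-1) * phi0 x).
    by apply/funext => x; rewrite mulN1r.
  apply: getPex; exists (fun x => v x + (-1) * pderivs (rev a) phi0 x).
  apply: is_weak_deriv_lin => //.
  exact: (is_weak_deriv_Ck oO a2 (test_function_Ck (k := 2) tphi0)).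
have w1 := weak _ _ su1 tphi; have w2 := weak _ _ su2 tpsi.
rewrite -/D1 in w1; rewrite -/D2 in w2.
pose z x := w x + (-1) * (phi x + (-1) * psi x).
have cz : Ck 2 O z by apply: Ck_lin => //; exact: test_function_Ck.
have wz : is_weak_deriv O a z (fun x => D1 x + (-1) * D2 x).
  have := is_weak_deriv_lin (-1) oO w1 w2; congr is_weak_deriv.
  by apply/funext => x; rewrite /z wE; ring.
have zae := weak_deriv_unique oO (is_weak_deriv_Ck oO a2 cz) wz.
have mD (D u : 'rV[R]_n -> R) : is_weak_deriv O a u D -> measurable_fun O D.
  by case=> _ [].
have mD1 := mD _ _ w1; have mD2 := mD _ _ w2.
have mz : measurable_fun O (pderivs a' z) by rewrite -aE; apply: mD (is_weak_deriv_Ck oO a2 cz).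
have b1 : (\int[leb]_(x in O) (D1 x ^+ 2)%:E <= (d ^+ 2)%:E)%E.
  by apply: Lnorm2_sqr => //; exact: le_lt_trans (sobolev_norm_ge _ _ _ a2) phid.
have b2 : (\int[leb]_(x in O) (D2 x ^+ 2)%:E <= (d ^+ 2)%:E)%E.
  by apply: Lnorm2_sqr => //; exact: le_lt_trans (sobolev_norm_ge _ _ _ a2) psid.
apply: int_le_sqr => //.
have mE (f : 'rV[R]_n -> R) : measurable_fun O f ->
    measurable_fun O (EFin \o (fun x => f x ^+ 2)).
  by move=> mf; apply/measurable_EFinP; exact: measurable_funX.
have mD12 : measurable_fun O (fun x => D1 x + (-1) * D2 x).
  by apply: measurable_funD => //; apply: measurable_funM.
rewrite (ge0_ae_eq_integral (g := EFin \o (fun x => (D1 x + (-1) * D2 x) ^+ 2)) mO (mE _ mz) (mE _ mD12)).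
- have mtwo (f : 'rV[R]_n -> R) : measurable_fun O f ->
      measurable_fun O (fun x => (2%:E * (f x ^+ 2)%:E)%E).
    by move=> mf; apply: measurable_funeM; exact: mE.
  apply: (@le_trans _ _ (\int[leb]_(x in O) (2%:E * (D1 x ^+ 2)%:E + 2%:E * (D2 x ^+ 2)%:E))%E).
    apply: ge0_le_integral => //.
    + by move=> x _; rewrite lee_fin sqr_ge0.
    + exact: mE.
    + by apply: emeasurable_funD; exact: mtwo.
    + move=> x _; rewrite -!EFinM -EFinD lee_fin; move: (D1 x) (D2 x) => p q.
      by have := sqr_ge0 (p + q); rewrite !expr2; nra.
  rewrite ge0_integralD//; first last.
  + exact: mtwo.
  + by move=> x _; rewrite mule_ge0// lee_fin sqr_ge0.
  + exact: mtwo.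
  + by move=> x _; rewrite mule_ge0// lee_fin sqr_ge0.
  rewrite !ge0_integralZl//; try exact: mE; try by move=> x _; rewrite lee_fin sqr_ge0.
  apply: (@le_trans _ _ (2%:E * (d ^+ 2)%:E + 2%:E * (d ^+ 2)%:E)%E).
    have two0 : (0 <= 2%:E :> \bar R)%E by rewrite lee_fin.
    exact: leeD (lee_wpmul2l two0 b1) (lee_wpmul2l two0 b2).
  by rewrite -!EFinM -EFinD lee_fin; lra.
- by move=> x _; rewrite lee_fin sqr_ge0.
- by move=> x _; rewrite lee_fin sqr_ge0.
- by apply: filterS zae => x h Ox /=; rewrite -aE h.
Qed.

End L2_approximation.

Section zero_integrals.
Context {R : realType} {n : nat}.
Implicit Types (O K : set 'rV[R]_n) (f g : 'rV[R]_n -> R).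
Local Notation leb := (lebesgue_rV R n).

Definition null_integral O f : Prop :=
  leb.-integrable O (EFin \o f) /\ \int[leb]_(x in O) f x = 0.

Lemma null_integral_lin O f g (c : R) : measurable O -> null_integral O f ->
  null_integral O g -> null_integral O (fun x => f x + c * g x).
Proof.
move=> mO [fi f0] [gi g0]; have cgi := integrableZl mO c gi.
split; first exact: (integrableD mO fi cgi).
by rewrite RintegralD// RintegralZl// f0 g0 mulr0 addr0.
Qed.

Lemma null_integral_cst0 O : measurable O -> null_integral O (fun=> 0).
Proof. by move=> mO; split; [exact: integrable0|rewrite Rintegral_cst// mul0r]. Qed.

Lemma null_integralZ O f (c : R) : measurable O -> null_integral O f ->
  null_integral O (fun x => c * f x).
Proof.
move=> mO hf; have := null_integral_lin c mO (null_integral_cst0 mO) hf.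
by congr null_integral; apply/funext => x; rewrite add0r.
Qed.

Lemma null_integral_sum O (I : Type) (s : seq I) (F : I -> 'rV[R]_n -> R) :
  measurable O -> (forall i, null_integral O (F i)) ->
  null_integral O (fun x => \sum_(i <- s) F i x).
Proof.
move=> mO hF; elim: s => [|i s IH].
  have := null_integral_cst0 mO; congr null_integral.
  by apply/funext => x; rewrite big_nil.
have := null_integral_lin 1 mO (hF i) IH; congr null_integral.
by apply/funext => x; rewrite big_cons mul1r.
Qed.

Lemma le_Rintegral_null O f g Z : measurable O -> null_integral O Z ->
  leb.-integrable O (EFin \o f) -> leb.-integrable O (EFin \o g) ->
  (forall x, O x -> f x + Z x <= g x) ->
  \int[leb]_(x in O) f x <= \int[leb]_(x in O) g x.
Proof.
move=> mO [Zi Z0] fi gi fg.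
rewrite -[leLHS]addr0 -Z0 -RintegralD//; apply: le_Rintegral => //.
exact: (integrableD mO fi Zi).
Qed.

Lemma null_integral_partial O K i f g : open O -> compact K -> K `<=` O ->
  (forall x, is_derive x (delta_mx 0 i : 'rV[R]_n) f (g x)) -> continuous g ->
  (forall x, ~ K x -> f x = 0) -> null_integral O g.
Proof.
move=> oO cK KO df cg f0; have mO := open_rV_measurable oO.
have g0 := derive_out_support (compact_rV_closed cK) f0 df.
split.
  apply: (@extend0_integrable _ _ O K) => // x Ox; [exact: cg|exact: g0].
rewrite Rintegral_mkcond restrict_support; last by move=> x Ox; apply: g0 => /KO.
have [M M0 KM] := bounded_sub_box (compact_bounded cK).
rewrite /Rintegral; suff -> : (\int[leb]_x (g x)%:E = 0)%E by [].
apply: (@integral_partial_eq0 _ _ i f g M) => // x [j xj]; apply: f0.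
by move=> /KM /(_ j); rewrite !mxE -ltr_norml ltNge (ltW xj).
Qed.

End zero_integrals.

Section zero_data.
Context {R : realType} {n : nat}.
Implicit Types (O K : set 'rV[R]_n) (x : 'rV[R]_n) (u v w z chi : 'rV[R]_n -> R).
Local Notation leb := (lebesgue_rV R n).
Variable A : 'M[R]_n.
Hypothesis A_pos : symmetric_posdef A.

Lemma sqr_sum_le (I : Type) (s : seq I) (F : I -> R) :
  (\sum_(i <- s) F i) ^+ 2 <= 2 ^+ size s * \sum_(i <- s) F i ^+ 2.
Proof.
elim: s => [|i s IH]; first by rewrite !big_nil expr0n mulr0.
rewrite !big_cons /= [X in _ <= X * _]exprS.
have p1 : 1 <= 2 ^+ size s :> R by rewrite exprn_ege1// ler1n.
have S0 : 0 <= \sum_(j <- s) F j ^+ 2 by apply: sumr_ge0 => j _; exact: sqr_ge0.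
move: IH p1 S0; move: (\sum_(j <- s) F j) (2 ^+ size s) (F i) (\sum_(j <- s) F j ^+ 2).
move=> S p a T IH p1 T0; rewrite !expr2 in IH *.
have h1 := sqr_ge0 (a - S); rewrite expr2 in h1.
have h2 : a * a <= p * (a * a) by rewrite ler_peMl// -expr2 sqr_ge0.
by lra.
Qed.

Let N : R := 2 ^+ size (index_enum 'I_n).
Let C : R := N * N * \sum_i \sum_j A i j ^+ 2.

Let C_ge0 : 0 <= C.
Proof.
rewrite mulr_ge0 ?mulr_ge0 ?exprn_ge0//.
by apply: sumr_ge0 => i _; apply: sumr_ge0 => j _; exact: sqr_ge0.
Qed.

Let sqrA_le i j : A i j ^+ 2 <= \sum_i \sum_j A i j ^+ 2.
Proof.
rewrite (bigD1 i)//= (bigD1 j)//= -addrA lerDl addr_ge0//.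
  by apply: sumr_ge0 => k _; exact: sqr_ge0.
by apply: sumr_ge0 => k _; apply: sumr_ge0 => l _; exact: sqr_ge0.
Qed.

Let Lop_sqr_le z x : Lop A z x ^+ 2 <=
  C * \sum_i \sum_j pderivs [:: i; j] z x ^+ 2.
Proof.
rewrite LopE; apply: (le_trans (sqr_sum_le _ _)).
rewrite /C -!mulrA ler_pM2l ?exprn_gt0//.
rewrite (mulrA N) mulr_sumr; apply: ler_sum => i _.
apply: (le_trans (sqr_sum_le _ _)); rewrite -mulrA ler_pM2l ?exprn_gt0//.
rewrite mulr_sumr; apply: ler_sum => j _.
by rewrite exprMn ler_wpM2r ?sqr_ge0.
Qed.

Lemma null_integral_Lop O chi : open O -> test_function O chi ->
  null_integral O (Lop A chi).
Proof.
move=> oO [cchi [K [cK KO chi0]]]; have mO := open_rV_measurable oO.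
rewrite (funext (LopE A chi)); do 2 (apply: null_integral_sum => // ?).
apply: null_integralZ => //.
have cd a k : Ck k setT (pderivs a chi) by apply: Ck_pderivs; exact: cchi.
set j := (X in pderivs [:: _; X]); set i := (X in pderivs [:: X; _]).
apply: (@null_integral_partial _ _ O K i (pderivs [:: j] chi)) => //.
- by move=> x; exact: Ck_is_derive (cd [:: j] 1%N) _.
- by move=> x; exact: Ck_continuous (cd [:: i; j] 0%N) _.
- apply: (derive_out_support (compact_rV_closed cK) chi0) => x.
  exact: Ck_is_derive (cchi 1%N) _.
Qed.

(** Integrating psi chi L(chi) by parts twice moves both derivatives onto the
    weight psi and leaves a gradient term of constant sign. *)
Lemma null_integral_energy O chi (psi : 'rV[R]_n -> R) : open O -> test_function O chi ->
  smooth psi ->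
  null_integral O (fun x => \sum_i \sum_j A i j *
    (2 * psi x * (pderiv i chi x * pderiv j chi x) +
     2 * psi x * chi x * pderivs [:: i; j] chi x -
     pderivs [:: j; i] psi x * chi x ^+ 2)).
Proof.
move=> oO [cchi [K [cK KO chi0]]] sp; have mO := open_rV_measurable oO.
apply: null_integral_sum => // i; apply: null_integral_sum => // j.
apply: null_integralZ => //.
have cd a k : Ck k setT (pderivs a chi) by apply: Ck_pderivs; exact: cchi.
have dchi a k x : is_derive x (delta_mx 0 k : 'rV[R]_n) (pderivs a chi) (pderivs (k :: a) chi x).
  exact: Ck_is_derive (cd a 1%N) _.
have cchi' a : continuous (pderivs a chi) by move=> x; exact: Ck_continuous (cd a 0%N) _.
have cpsi a : continuous (pderivs a psi) by apply/smooth_continuous/smooth_pderivs.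
have cM (f g : 'rV[R]_n -> R) : continuous f -> continuous g -> continuous (fun x => f x * g x).
  by move=> cf cg x; apply: (@continuousM _ _ f g); [exact: cf|exact: cg].
have cD (f g : 'rV[R]_n -> R) : continuous f -> continuous g -> continuous (fun x => f x + g x).
  by move=> cf cg x; apply: (@continuousD _ _ _ f g); [exact: cf|exact: cg].
have dpsi a k x : is_derive x (delta_mx 0 k : 'rV[R]_n) (pderivs a psi) (pderivs (k :: a) psi x).
  by apply: smooth_pderivP; exact: smooth_pderivs.
have n1 := @null_integral_partial _ _ O K i _ _ oO cK KO
  (fun x => is_derive_mul (dpsi [::] i x) (is_derive_mul (dchi [::] i x) (dchi [:: j] i x))).
have n2 := @null_integral_partial _ _ O K j _ _ oO cK KO
  (fun x => is_derive_mul (dpsi [:: i] j x) (is_derive_mul (dchi [::] j x) (dchi [::] j x))).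
have {}n1 := n1 (cD _ _ (cM _ _ (cpsi _) (cM _ _ (cchi' _) (cchi' _)))
  (cM _ _ (cpsi _) (cD _ _ (cM _ _ (cchi' _) (cchi' _)) (cM _ _ (cchi' _) (cchi' _))))).
have {}n2 := n2 (cD _ _ (cM _ _ (cpsi _) (cM _ _ (cchi' _) (cchi' _)))
  (cM _ _ (cpsi _) (cD _ _ (cM _ _ (cchi' _) (cchi' _)) (cM _ _ (cchi' _) (cchi' _))))).
have {}n1 := n1 ltac:(by move=> x Kx; rewrite /= chi0// mul0r mulr0).
have {}n2 := n2 ltac:(by move=> x Kx; rewrite /= chi0// mul0r mulr0).
have := null_integral_lin (-1) mO (null_integralZ 2 mO n1) n2; congr null_integral.
apply/funext => x /=; move: (psi x) (chi x) (pderiv i psi x) (pderiv i chi x) (pderiv j chi x).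
move: (pderiv j (pderiv i psi) x) (pderiv i (pderiv j chi) x) => a b c d e f g.
by rewrite expr2; ring.
Qed.

Lemma sum_delta2 (i0 : 'I_n) (k : R) :
  \sum_i \sum_j A i j * (2 * (i0 == i)%:R * (i0 == j)%:R * k) = 2 * A i0 i0 * k.
Proof.
rewrite (bigD1 i0)//= [X in _ + X]big1 => [|i ii0]; last first.
  by rewrite big1// => j _; rewrite eq_sym (negbTE ii0) mulr0 !mul0r mulr0.
rewrite addr0 (bigD1 i0)//= big1 => [|j ji0]; last first.
  by rewrite [i0 == j]eq_sym (negbTE ji0) mulr0 mul0r mulr0.
by rewrite eqxx addr0; move: (A i0 i0) => a; rewrite mulr1n; ring.
Qed.

Lemma energy_integrandE (i0 : 'I_n) (psi : 'rV[R]_n -> R) chi x :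
  (forall i j, pderivs [:: j; i] psi x = - (2 * (i0 == i)%:R * (i0 == j)%:R)) ->
  \sum_i \sum_j A i j *
    (2 * psi x * (pderiv i chi x * pderiv j chi x) +
     2 * psi x * chi x * pderivs [:: i; j] chi x -
     pderivs [:: j; i] psi x * chi x ^+ 2) =
  2 * psi x * (\sum_i \sum_j A i j * (pderiv i chi x * pderiv j chi x)) +
  2 * psi x * chi x * Lop A chi x + 2 * A i0 i0 * chi x ^+ 2.
Proof.
move=> ddpsi; rewrite -(sum_delta2 i0 (chi x ^+ 2)) LopE !mulr_sumr -!big_split.
apply: eq_bigr => i _; rewrite !mulr_sumr -!big_split; apply: eq_bigr => j _.
rewrite ddpsi; move: (A i j) (psi x) (chi x) (pderiv i chi x) (pderiv j chi x).
by move: (pderivs [:: i; j] chi x) (_%:R) (_%:R) => p q r s t v k l /=; ring.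
Qed.

Lemma energy_arith (a M D S Q p k l v z : R) : 0 < a -> 0 <= M -> 0 <= Q ->
  0 <= p -> p <= M -> z = 2 * p * Q + 2 * p * k * l + 2 * a * k ^+ 2 ->
  l ^+ 2 <= D * S -> (v + (-1) * k) ^+ 2 <= S ->
  v ^+ 2 + - (2 / a) * z <= (2 + 2 * M ^+ 2 * D / a ^+ 2) * S.
Proof.
move=> a0 M0 Q0 p0 pM -> lS S1; set y := 2 * p * Q + _ + _.
have pl : p ^+ 2 * l ^+ 2 <= M ^+ 2 * (D * S).
  by apply: ler_pM; rewrite ?sqr_ge0// ler_pXn2r.
have H1 : a ^+ 2 * k ^+ 2 <= a * y + M ^+ 2 * (D * S).
  apply: (@le_trans _ _ (a * y + p ^+ 2 * l ^+ 2)); last by rewrite lerD2l.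
  rewrite -subr_ge0 (_ : _ - _ = 2 * (a * (p * Q)) + (a * k + p * l) ^+ 2).
    apply: addr_ge0; last exact: sqr_ge0.
    by apply: mulr_ge0 => //; apply: mulr_ge0; [exact: ltW|exact: mulr_ge0].
  by rewrite /y; ring.
have H2 : k ^+ 2 <= (a * y + M ^+ 2 * (D * S)) / a ^+ 2.
  by rewrite ler_pdivlMr ?exprn_gt0// mulrC.
have -> : (2 + 2 * M ^+ 2 * D / a ^+ 2) * S =
    2 * S + 2 * ((a * y + M ^+ 2 * (D * S)) / a ^+ 2) + - (2 / a) * y.
  by move: y H1 H2 => y _ _; field; rewrite gt_eqF.
rewrite lerD2r; apply: (@le_trans _ _ (2 * (v + (-1) * k) ^+ 2 + 2 * k ^+ 2)).
  rewrite -subr_ge0 (_ : _ - _ = (v - 2 * k) ^+ 2) ?sqr_ge0//; ring.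
by apply: lerD; rewrite ler_pM2l.
Qed.

Lemma hessian_int_le O u1 u2 w : open O -> sobolev0 2 2%:E O u1 ->
  sobolev0 2 2%:E O u2 -> Ck 2 O w -> (forall x, w x = u1 x + (-1) * u2 x) ->
  forall e : R, 0 < e -> exists2 chi, test_function O chi &
    int_le O (fun x => (w x + (-1) * chi x) ^+ 2 +
      \sum_i \sum_j pderivs [:: i; j] (fun x => w x + (-1) * chi x) x ^+ 2) e.
Proof.
move=> oO s1 s2 cw wE e e0; have mO := open_rV_measurable oO.
pose T : R := \sum_(i <- index_enum 'I_n) \sum_(j <- index_enum 'I_n) 1.
have T0 : 0 <= T by apply: sumr_ge0 => i _; apply: sumr_ge0 => j _; exact: ler01.
have T1 : 0 < 1 + T by rewrite ltr_pwDl.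
pose e' := e / (1 + T).
have [chi tchi chi_le] := approx_L2 oO s1 s2 cw wE (divr_gt0 e0 T1).
exists chi => //.
have -> : e = e' + \sum_(i <- index_enum 'I_n) \sum_(j <- index_enum 'I_n) e'.
  transitivity (e' * (1 + T)); first by rewrite /e' divfK// gt_eqF.
  rewrite mulrDr mulr1 mulr_sumr; congr (_ + _); apply: eq_bigr => i _.
  by rewrite mulr_sumr; apply: eq_bigr => j _; rewrite mulr1.
apply: int_leD => //; first exact: (chi_le [::]).
by do 2 (apply: int_le_sum => // ?); exact: (chi_le [:: _; _]).
Qed.

(** The constant is zero because L(chi) integrates to zero for every test function
    chi. The energy identity with the weight M - x_0^2, whose image under L is the
    negative constant -2 A_00, then bounds the L2 norm of chi by that of L(chi),
    and both L(chi) and w - chi tend to 0. *)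
Lemma zero_data_unique (i0 : 'I_n) O u1 u2 w (c : R) : open O -> bounded_set O ->
  sobolev0 2 2%:E O u1 -> sobolev0 2 2%:E O u2 -> Ck 2 O w ->
  (forall x, w x = u1 x + (-1) * u2 x) -> (forall x, O x -> Lop A w x = c) ->
  forall x, O x -> w x = 0.
Proof.
move=> oO bO s1 s2 cw wE Lw x Ox; have mO := open_rV_measurable oO.
have approx := hessian_int_le oO s1 s2 cw wE.
have muO := lebesgue_rV_bounded mO bO.
pose mu := fine (leb O).
have mu0 : 0 < mu.
  by rewrite fine_gt0// muO andbT; exact: lebesgue_rV_open_gt0 Ox.
have Lchi chi y : test_function O chi -> O y ->
    (c - Lop A chi y) ^+ 2 <= C * ((w y + (-1) * chi y) ^+ 2 +
      \sum_i \sum_j pderivs [:: i; j] (fun x => w x + (-1) * chi x) y ^+ 2).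
  move=> tchi Oy; have cchi : Ck 2 O chi by exact: test_function_Ck.
  have <- : Lop A (fun x => w x + (-1) * chi x) y = c - Lop A chi y.
    by rewrite (Lop_lin A (-1) oO cw cchi Oy) Lw// mulN1r.
  apply: (le_trans (Lop_sqr_le _ _)); rewrite ler_wpM2l// lerDr; exact: sqr_ge0.
have c0 : c = 0.
  apply/eqP; apply: contraT => cn0.
  have c2 : 0 < c ^+ 2 by rewrite exprn_even_gt0.
  have C1 : 0 < C + 1 by rewrite ltr_wpDl.
  pose e := c ^+ 2 * mu / (2 * (C + 1)).
  have cmu : 0 < c ^+ 2 * mu by exact: mulr_gt0.
  have e0 : 0 < e by apply: divr_gt0 => //; exact: mulr_gt0.
  have [chi tchi [Si Se]] := approx e e0.
  have cst_int : leb.-integrable O (EFin \o (fun=> c ^+ 2)).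
    apply: measurable_bounded_integrable => //.
    exists (c ^+ 2); split; first exact: num_real.
    by move=> M cM y _; rewrite /= ger0_norm ?ltW.
  have : c ^+ 2 * mu <= C * e.
    rewrite -(Rintegral_cst leb mO); apply: (@le_trans _ _ (C * \int[leb]_(y in O)
      ((w y + (-1) * chi y) ^+ 2 +
       \sum_i \sum_j pderivs [:: i; j] (fun x => w x + (-1) * chi x) y ^+ 2))); last first.
      by rewrite ler_wpM2l.
    rewrite -RintegralZl//.
    apply: (le_Rintegral_null mO (null_integralZ (- 2 * c) mO (null_integral_Lop oO tchi))) => //.
      exact: (integrableZl mO C Si).
    move=> y Oy; apply: le_trans (Lchi chi y tchi Oy).
    move: (Lop A chi y) => l; have := sqr_ge0 l; rewrite !expr2; lra.
  rewrite leNgt => /negP; case; apply: (@lt_le_trans _ _ ((C + 1) * e)).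
    by rewrite ltr_pM2r// ltrDl.
  have -> : (C + 1) * e = c ^+ 2 * mu / 2.
    by rewrite /e; field; rewrite gt_eqF.
  by rewrite ler_pdivrMr// ler_peMr ?ler1n// ltW.
have [M0 M00 OM] := bounded_sub_box bO.
pose M := M0 ^+ 2.
pose psi (y : 'rV[R]_n) := M - y 0 i0 * y 0 i0.
have spsi : smooth psi.
  by apply: smoothB; [exact: smooth_cst|apply: smoothM; exact: smooth_coord].
have dpsi i : pderiv i psi = fun y => - (2 * (i0 == i)%:R) * y 0 i0.
  apply: pderivE => y; have dy := is_derive_coord i0 i y.
  apply: (is_derive_eq (is_deriveB (is_derive_cst M y _) (is_derive_mul dy dy))).
  by ring.
have ddpsi j i y : pderivs [:: j; i] psi y = - (2 * (i0 == i)%:R * (i0 == j)%:R).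
  rewrite /= dpsi.
  rewrite (pderivE (fun y => is_derive_cmul (- (2 * (i0 == i)%:R)) (is_derive_coord i0 j y))).
  by rewrite mulNr.
have psi_ge0 y : O y -> 0 <= psi y.
  move=> /OM /(_ i0); rewrite !mxE -ltr_norml => yM; rewrite subr_ge0 -expr2 -real_normK ?num_real//.
  by rewrite ler_pXn2r ?nnegrE// ltW.
have psi_le y : psi y <= M by rewrite gerBl -expr2 sqr_ge0.
pose a := A i0 i0.
have a0 : 0 < a.
  have d0 : delta_mx 0 i0 != 0 :> 'rV[R]_n.
    by apply/eqP => /rowP/(_ i0); rewrite !mxE !eqxx => /eqP; rewrite oner_eq0.
  have := posdefE A_pos d0; rewrite (bigD1 i0)//= (bigD1 i0)//= !big1 => [|i ii0|j ji0].
  - by rewrite !mxE !eqxx !addr0 !mulr1.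
  - by rewrite big1// => j _; rewrite !mxE eqxx (negbTE ii0) mul0r mulr0.
  - by rewrite !mxE eqxx (negbTE ji0) mulr0 mulr0.
pose C2 := 2 + 2 * M ^+ 2 * C / a ^+ 2.
have C20 : 0 <= C2.
  apply: addr_ge0 => //; apply: divr_ge0; last exact: sqr_ge0.
  by apply: mulr_ge0 => //; apply: mulr_ge0 => //; exact: sqr_ge0.
have key chi : test_function O chi -> exists2 Z, null_integral O Z &
    forall y, O y -> w y ^+ 2 + Z y <= C2 * ((w y + (-1) * chi y) ^+ 2 +
      \sum_i \sum_j pderivs [:: i; j] (fun x => w x + (-1) * chi x) y ^+ 2).
  move=> tchi; have := null_integral_energy oO tchi spsi.
  set Z := (X in null_integral O X) => nZ.
  exists (fun y => (- (2 / a)) * Z y); first exact: null_integralZ.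
  move=> y Oy; have := Lchi chi y tchi Oy; rewrite c0 sub0r sqrrN.
  set S := (X in _ <= C * X) => LS.
  have S1 : (w y + (-1) * chi y) ^+ 2 <= S.
    rewrite lerDl; apply: sumr_ge0 => i _; apply: sumr_ge0 => j _; exact: sqr_ge0.
  have ZE : Z y = 2 * psi y * (\sum_i \sum_j A i j * (pderiv i chi y * pderiv j chi y)) +
      2 * psi y * chi y * Lop A chi y + 2 * a * chi y ^+ 2.
    by apply: energy_integrandE => i j; exact: ddpsi.
  have Q0 : 0 <= \sum_i \sum_j A i j * (pderiv i chi y * pderiv j chi y).
    pose g := \row_i pderiv i chi y : 'rV[R]_n.
    have [g0|/(posdefE A_pos)/ltW] := eqVneq g 0.
      apply: sumr_ge0 => i _; apply: sumr_ge0 => j _.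
      by have /rowP/(_ i) := g0; rewrite !mxE => ->; rewrite mul0r mulr0.
    congr (0 <= _); apply: eq_bigr => i _; apply: eq_bigr => j _.
    by rewrite !mxE.
  have p0 := psi_ge0 y Oy; have pM := psi_le y.
  exact: energy_arith a0 (sqr_ge0 M0) Q0 p0 pM ZE LS S1.
have mw : measurable_fun O w by exact: (Ck_pderivs_measurable oO (a := [::]) cw).
have mw2 : measurable_fun O (fun y => w y ^+ 2) by exact: measurable_funX.
have iw : leb.-integrable O (EFin \o (fun y => w y ^+ 2)).
  have [chi tchi [Si _]] := approx 1 ltr01; have [Z [Zi _] wZ] := key chi tchi.
  apply: (le_integrable mO _ _ (integrableB mO (integrableZl mO C2 Si) Zi)).
    exact/measurable_EFinP.
  move=> y Oy; rewrite /= lee_fin ger0_norm ?sqr_ge0//.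
  by apply: le_trans (ler_norm _); rewrite lerBrDr; exact: wZ.
pose I := \int[leb]_(y in O) (w y ^+ 2).
have I_le e : 0 < e -> I <= C2 * e.
  move=> e0; have [chi tchi [Si Se]] := approx e e0; have [Z nZ wZ] := key chi tchi.
  apply: (@le_trans _ _ (C2 * \int[leb]_(y in O) ((w y + (-1) * chi y) ^+ 2 +
       \sum_i \sum_j pderivs [:: i; j] (fun x => w x + (-1) * chi x) y ^+ 2))); last first.
    by rewrite ler_wpM2l.
  rewrite -RintegralZl//.
  by apply: (le_Rintegral_null mO nZ) => //; exact: (integrableZl mO C2 Si).
have I0 : I = 0.
  apply/eqP; rewrite eq_le Rintegral_ge0 ?andbT => [|y _]; last exact: sqr_ge0.
  rewrite leNgt; apply/negP => I0.
  have C21 : 0 < 2 * (C2 + 1) by rewrite mulr_gt0// ltr_wpDl.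
  have := I_le (I / (2 * (C2 + 1))) (divr_gt0 I0 C21).
  rewrite mulrA ler_pdivlMr// leNgt => /negP; apply.
  by have : 0 <= C2 * I by [rewrite mulr_ge0// ltW]; lra.
have aew : {ae leb, forall y, O y -> w y = 0}.
  have mE : measurable_fun O (EFin \o (fun y => w y ^+ 2)) by exact/measurable_EFinP.
  have abs0 : (\int[leb]_(y in O) `|(EFin \o (fun y => (w y ^+ 2)%R)) y| = 0)%E.
    transitivity (\int[leb]_(y in O) (w y ^+ 2)%:E)%E.
      by apply: eq_integral => y _ /=; rewrite ger0_norm// sqr_ge0.
    by rewrite -[LHS]fineK ?[X in X%:E]I0//; exact: integrable_fin_num.
  have := (ae_eq_integral_abs leb mO mE).1 abs0.
  by apply: filterS => y h /h [] /eqP; rewrite expf_eq0 => /eqP.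
apply/eqP; apply: contraT => wx.
pose U := O `&` [set y | w y != 0].
have oU : open U.
  rewrite openE => y [Oy wy]; apply: filterI; first exact: open_nbhs_nbhs.
  have wN : nbhs (w y) [set t | t != 0].
    by apply: open_nbhs_nbhs; split; [exact: open_neq|exact: wy].
  exact: (Ck_continuous cw Oy wN).
have [y [Oy wy] h] := ae_open_witness oU (conj Ox wx : U x) aew.
by move: wy; rewrite /= h// eqxx.
Qed.

End zero_data.

Theorem corollary15 (R : realType) (n : nat) (n_gt0 : (0 < n)%N)
    (Omega : set 'rV[R]_n) (Omega_open : open Omega)
    (Omega_bounded : bounded_set Omega) (Omega_connected : connected Omega)
    (A : 'M[R]_n) (A_pos : symmetric_posdef A)
    (h : R -> R) (h_C1 : C1 h) (h_ge0 : forall t, 0 <= h t)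
    (h_lc : level_convex h)
    (h_levels : forall t : R, ([set s | h s = t] #<= `I_2)%card)
    (g : 'rV[R]_n -> R) (g_W : W2oo Omega g) :
  at_most_one_on Omega
    (Ck 3 Omega `&` W2oo_g Omega g `&`
     AM2 (E_oo (fun X => h (mxdot A X))) Omega) /\
  at_most_one_on Omega
    (Ck 3 Omega `&` W2oo_g Omega g `&`
     [set u | forall x, Omega x ->
        cube_contract (derive1 h (mxdot A (hessian u x)) *: A) u x = 0]).
Proof.
pose L := Lop A.
have const u : Ck 3 Omega u ->
    (forall x k, Omega x -> derive1 h (L u x) * dLop A u k x = 0) ->
    forall x y, Omega x -> Omega y -> L u x = L u y.
  move=> cu grad0 x y Ox Oy; have [dh _] := h_C1.
  have hconst z : Omega z -> h (L u z) = h (L u x).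
    move=> Oz; apply: (partial0_connected (p := h \o L u) Omega_open Omega_connected) => // v Ov i.
    rewrite -(grad0 v i Ov); apply: (@is_derive_compR _ _ h (L u)).
      by rewrite derive1E; exact: derivableP.
    exact: Lop_is_derive cu Ov.
  apply: (level_le2_const (h_levels (h (L u x))) Omega_connected _ hconst) => // z Oz.
  exact: Lop_continuous (Ck_le _ cu) Oz.
have unique u v : Ck 3 Omega u -> Ck 3 Omega v -> W2oo_g Omega g u -> W2oo_g Omega g v ->
    (forall x k, Omega x -> derive1 h (L u x) * dLop A u k x = 0) ->
    (forall x k, Omega x -> derive1 h (L v x) * dLop A v k x = 0) ->
    forall x, Omega x -> u x = v x.
  move=> cu cv [_ gu] [_ gv] du dv x Ox.
  have cu2 : Ck 2 Omega u by exact: Ck_le cu.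
  have cv2 : Ck 2 Omega v by exact: Ck_le cv.
  have two : 1 < 2 :> R by rewrite ltr1n.
  have wE y : u y + (-1) * v y = (u \- g)%R y + (-1) * (v \- g)%R y.
    by rewrite /=; ring.
  have Lw y : Omega y -> L (fun x => u x + (-1) * v x) y = L u x + (-1) * L v x.
    move=> Oy; rewrite /L (Lop_lin A (-1) Omega_open cu2 cv2 Oy).
    by rewrite -/L (const u cu du y x Oy Ox) (const v cv dv y x Oy Ox).
  have := zero_data_unique A_pos (Ordinal n_gt0) Omega_open Omega_bounded
    (gu 2 two) (gv 2 two) (Ck_lin (-1) Omega_open cu2 cv2) wE Lw Ox.
  by rewrite mulN1r => /eqP; rewrite subr_eq0 => /eqP.
split => u v [[cu gu] hu] [[cv gv] hv]; apply: unique => //.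
- by move=> x k; exact: AM2_gradient_eq0 hu x k.
- by move=> x k; exact: AM2_gradient_eq0 hv x k.
- by move=> x k Ox; apply: (cube_contract_eq0 A_pos); exact: hu.
- by move=> x k Ox; apply: (cube_contract_eq0 A_pos); exact: hv.
Qed.
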